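(* Let $l$ be an odd prime. Let $d$ be a squarefree integer not equal to one such that $F=\mathbb{Q}(\sqrt{d})$ is an imaginary quadratic field with class number $h_F=l$. Let $L$ be the Hilbert class field of $F$ and let $\Delta_F$ be the discriminant of $F$. Let $p$ and $q$ be distinct odd positive primes such that $\left(\frac{p}{q}\right)=-1$ and such that $p$ or $q$ is congruent to $1$ modulo $4$. Then the quaternion algebra $H_L(p,q)$ is a division algebra if and only if $\left(\frac{\Delta_F}{p}\right)=1$ or $\left(\frac{\Delta_F}{q}\right)=1$.
   Context: For a field $F$ of characteristic $\neq 2$ and $a,b\in F\setminus\{0\}$, $H_F(a,b)$ denotes the generalized quaternion algebra over $F$ with basis $1,i,j,k$ and relations $i^2=a$, $j^2=b$, $ij=-ji=k$. $\left(\frac{m}{\ell}\right)$ is the Legendre symbol for an odd prime $\ell$, equal to $0$ if $\ell\mid m$. The discriminant of $\mathbb{Q}(\sqrt d)$ is $d$ if $d\equiv 1\pmod 4$ and $4d$ otherwise. *)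

(* Defs.v *)
From HB Require Import structures.
From mathcomp Require Import all_boot all_order all_algebra all_fingroup.
From mathcomp Require Import all_solvable all_field.
From mathcomp Require Import boolp classical_sets functions cardinality.
From mathcomp Require Import ring.

Set Implicit Arguments.
Unset Strict Implicit.
Unset Printing Implicit Defensive.

Import Order.TTheory GRing.Theory Num.Theory.
Local Open Scope ring_scope.
Local Open Scope classical_set_scope.
Local Open Scope card_scope.

Definition squarefreez (d : int) : Prop :=
  forall n : nat, (n ^ 2 %| `|d|)%N -> n = 1%N.

Definition quad_disc (d : int) : int :=
  if (d == 1 %[mod 4])%Z then d else 4 * d.

Definition legendre (m : int) (p : nat) : int :=
  if (p%:Z %| m)%Z then 0
  else if [exists x : 'I_p, ((x : nat)%:Z ^+ 2 == m %[mod p%:Z])%Z] then 1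
  else -1.

Section Integers.
Variable K : fieldType.

Definition integers : set K := [set x | integralOver (intr : int -> K) x].

(* Closed under addition and under multiplication by algebraic integers;
   opposites are covered because -1 is an algebraic integer. *)
Definition is_submodule (I : set K) : Prop :=
  [/\ I 0, forall x y, I x -> I y -> I (x + y)
    & forall a x, integers a -> I x -> I (a * x)].

Definition is_ideal (I : set K) : Prop := is_submodule I /\ I `<=` integers.

Definition is_prime_ideal (P : set K) : Prop :=
  [/\ is_ideal P, ~ P 1
    & forall x y, integers x -> integers y -> P (x * y) -> P x \/ P y].

Definition submodule_gen (A : set K) : set K := smallest is_submodule A.

Definition ideal_mul (I J : set K) : set K :=
  submodule_gen [set z | exists x y, [/\ I x, J y & z = x * y]].

Definition ideal_exp (I : set K) (n : nat) : set K :=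
  iter n (ideal_mul I) integers.

Definition is_fractional_ideal (I : set K) : Prop :=
  [/\ is_submodule I, I <> [set 0]
    & exists2 c, integers c /\ c != 0 & forall x, I x -> integers (c * x)].

(* The coset of I modulo the group of principal fractional ideals: the
   product of I with the principal ideal generated by x is x I. *)
Definition ideal_class (I : set K) : set (set K) :=
  [set J | exists2 x : K, x != 0 & J = [set x * y | y in I]].

Definition class_group : set (set (set K)) :=
  [set ideal_class I | I in is_fractional_ideal].

Definition has_class_number (h : nat) : Prop := class_group #= `I_h.

End Integers.

Section Extension.
Variables (F : fieldExtType rat) (L : splittingFieldType F).

Definition lies_over (Q : set L) (P : set F) : Prop :=
  P = in_alg L @^-1` Q.

(* e is the exponent of Q in the factorization of P O_L: for ideals of a
   Dedekind domain, Q ^ n divides P O_L iff it contains P O_L. *)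
Definition has_ramification_index (P : set F) (Q : set L) (e : nat) : Prop :=
  let PL := submodule_gen (in_alg L @` P) in
  PL `<=` ideal_exp Q e /\ ~ (PL `<=` ideal_exp Q e.+1).

(* Residue fields are finite, so separability of the residue extensions is
   automatic. *)
Definition unramified_finite : Prop :=
  forall (P : set F) (Q : set L),
    is_prime_ideal P -> P <> [set 0] -> is_prime_ideal Q -> lies_over Q P ->
    has_ramification_index P Q 1.

(* Archimedean places are restrictions of absolute values along embeddings in
   the algebraic complex numbers: no real place of F becomes complex in L. *)
Definition unramified_infinite : Prop :=
  forall f : {rmorphism L -> algC},
    (forall a : F, f (a%:A) \is Num.real) -> forall x : L, f x \is Num.real.

Definition unramified_abelian : Prop :=
  [/\ galois 1%AS {:L}%AS, abelian 'Gal({:L} / 1),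
      unramified_finite & unramified_infinite].

End Extension.

(* The largest unramified abelian extension, up to F-isomorphism: it is one,
   and every other one has an F-embedding in it. *)
Definition is_hilbert_class_field
    (F : fieldExtType rat) (L : splittingFieldType F) : Prop :=
  unramified_abelian L /\
  forall M : splittingFieldType F, unramified_abelian M ->
    inhabited 'AHom(M, L).

(* Quat a b x0 x1 x2 x3 stands for x0 + x1 i + x2 j + x3 k, with i ^ 2 = a,
   j ^ 2 = b and k = i j = - j i. *)
Record quat (K : fieldType) (a b : K) :=
  Quat { q0 : K; q1 : K; q2 : K; q3 : K }.

Section Quaternion.
Variables (K : fieldType) (a b : K).
Local Notation H := (quat a b).
Implicit Types x y z : H.

Definition quat_tuple x := (q0 x, q1 x, q2 x, q3 x).
Definition tuple_quat (t : K * K * K * K) : H :=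
  let: (t0, t1, t2, t3) := t in Quat a b t0 t1 t2 t3.

Fact quat_tupleK : cancel quat_tuple tuple_quat.
Proof. by case. Qed.

HB.instance Definition _ := Choice.copy H (can_type quat_tupleK).

Definition quat_add x y : H :=
  Quat a b (q0 x + q0 y) (q1 x + q1 y) (q2 x + q2 y) (q3 x + q3 y).
Definition quat_opp x : H := Quat a b (- q0 x) (- q1 x) (- q2 x) (- q3 x).
Definition quat_zero : H := Quat a b 0 0 0 0.
Definition quat_one : H := Quat a b 1 0 0 0.
Definition quat_mul x y : H :=
  Quat a b
    (q0 x * q0 y + a * (q1 x * q1 y) + b * (q2 x * q2 y)
       - a * b * (q3 x * q3 y))
    (q0 x * q1 y + q1 x * q0 y - b * (q2 x * q3 y) + b * (q3 x * q2 y))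
    (q0 x * q2 y + q2 x * q0 y + a * (q1 x * q3 y) - a * (q3 x * q1 y))
    (q0 x * q3 y + q3 x * q0 y + q1 x * q2 y - q2 x * q1 y).
Definition quat_scale (c : K) x : H :=
  Quat a b (c * q0 x) (c * q1 x) (c * q2 x) (c * q3 x).

Local Ltac quat_ring :=
  repeat (case=> ? ? ? ?);
  rewrite /quat_add /quat_opp /quat_mul /quat_scale /quat_one /quat_zero /=;
  congr Quat; ring.

Fact quat_addA : associative quat_add. Proof. quat_ring. Qed.
Fact quat_addC : commutative quat_add. Proof. quat_ring. Qed.
Fact quat_add0 : left_id quat_zero quat_add. Proof. quat_ring. Qed.
Fact quat_addN : left_inverse quat_zero quat_opp quat_add.
Proof. quat_ring. Qed.

HB.instance Definition _ :=
  GRing.isZmodule.Build H quat_addA quat_addC quat_add0 quat_addN.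

Fact quat_mulA : associative quat_mul. Proof. quat_ring. Qed.
Fact quat_mul1l : left_id quat_one quat_mul. Proof. quat_ring. Qed.
Fact quat_mul1r : right_id quat_one quat_mul. Proof. quat_ring. Qed.
Fact quat_mulDl : left_distributive quat_mul quat_add. Proof. quat_ring. Qed.
Fact quat_mulDr : right_distributive quat_mul quat_add. Proof. quat_ring. Qed.
Fact quat_one_neq0 : quat_one != 0 :> H.
Proof. by apply/eqP => -[] /eqP; rewrite oner_eq0. Qed.

HB.instance Definition _ := GRing.Zmodule_isNzRing.Build H
  quat_mulA quat_mul1l quat_mul1r quat_mulDl quat_mulDr quat_one_neq0.

Fact quat_scaleA c e x : quat_scale c (quat_scale e x) = quat_scale (c * e) x.
Proof. by case: x => ? ? ? ?; rewrite /quat_scale /= !mulrA. Qed.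
Fact quat_scale1 : left_id 1 quat_scale.
Proof. by case=> ? ? ? ?; rewrite /quat_scale /= !mul1r. Qed.
Fact quat_scaleDr : right_distributive quat_scale +%R.
Proof. by move=> c x y; congr Quat; rewrite /= mulrDr. Qed.
Fact quat_scaleDl x : {morph quat_scale^~ x : c e / c + e}.
Proof. by move=> c e; congr Quat; rewrite /= mulrDl. Qed.

HB.instance Definition _ := GRing.Zmodule_isLmodule.Build K H
  quat_scaleA quat_scale1 quat_scaleDr quat_scaleDl.

Fact quat_scaleAl (c : K) (x y : H) : c *: (x * y) = (c *: x) * y.
Proof. by congr Quat; rewrite /=; ring. Qed.
HB.instance Definition _ := GRing.Lmodule_isLalgebra.Build K H quat_scaleAl.

Fact quat_scaleAr (c : K) (x y : H) : c *: (x * y) = x * (c *: y).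
Proof. by congr Quat; rewrite /=; ring. Qed.
HB.instance Definition _ := GRing.Lalgebra_isAlgebra.Build K H quat_scaleAr.

Definition quat_i : H := Quat a b 0 1 0 0.
Definition quat_j : H := Quat a b 0 0 1 0.
Definition quat_k : H := Quat a b 0 0 0 1.

Fact quat_relations :
  [/\ quat_i ^+ 2 = a%:A, quat_j ^+ 2 = b%:A,
      quat_i * quat_j = quat_k & quat_j * quat_i = - quat_k].
Proof. by rewrite !expr2; split; congr Quat; rewrite /=; ring. Qed.

Fact quat_basis (x0 x1 x2 x3 : K) :
  x0 *: 1 + x1 *: quat_i + x2 *: quat_j + x3 *: quat_k = Quat a b x0 x1 x2 x3.
Proof. by congr Quat; rewrite /=; ring. Qed.

End Quaternion.

Definition is_division_ring (A : nzRingType) : Prop :=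
  forall x : A, x != 0 -> exists y : A, x * y = 1 /\ y * x = 1.

(* Main.v *)
Require Import Defs.
From HB Require Import structures.
From mathcomp Require Import all_boot all_order all_algebra all_fingroup.
From mathcomp Require Import all_solvable all_field.
From mathcomp Require Import boolp classical_sets functions cardinality.
From mathcomp Require Import ring lra zify.

(* The degree of [L / F] is odd: otherwise the abelian extension [L / F]
   contains a square root of some [u] in [F] that is not a square in [F].  As
   [L / F] is unramified, the ideal of [u] is a square, and the odd class number
   makes [u] a unit up to squares, hence [-1]; but [F(i) / F] ramifies above 2.
   Indeed [d = -r] with [r] a prime congruent to 3 modulo 4, because an odd
   class number lets only one prime ramify in [F].

   The algebra [H_L(p, q)] splits iff [q] is a norm [u^2 - p v^2] over [L], and
   taking the product of the conjugates this descends along the odd degree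
   extension [L / F].  If [p] or [q] splits in [F], reduction modulo a prime
   above it and infinite descent show that [q] is not such a norm over [F].
   Otherwise let [p = 1] modulo 4, by symmetry, so that [p = a^2 + b^2] and [-1]
   is a norm.  If [q = r] then [q] is a norm because [-q] is a square.  If not,
   quadratic reciprocity gives the local conditions of Legendre's theorem for
   the conic [p x^2 + r y^2 = q z^2], whose rational point makes [-q] a norm. *)

(** Neither valuations nor factorizations of ideals are used. A prime [P] of F is handled through an
    element [y] that is not integral although [y * x] is integral for all [x] in [P]: multiplying by
    [y] lowers the order at [P] by one and creates no other pole. Orders are finite because F is
    completely integrally closed ([almost_integral]): if c is nonzero and all c x^n are integral,
    then so is x. The same fact shows that an element which stabilizes a fractional ideal is an
    integer, and it ends the infinite descent. The class group enters only as a finite set of odd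
    size, on which an ideal with principal square acts as an involution. The candidate for a square
    root of the ideal of u consists of the x with x^2 / u integral. That l exceeds 1 excludes d = -1
    and d = -2, where the integers form a Euclidean ring. What remains has d = 1 modulo 4, so 2 is
    unramified in F; this is what makes F(i) ramify above 2. *)

Set Implicit Arguments.
Unset Strict Implicit.
Unset Printing Implicit Defensive.

Import Order.TTheory GRing.Theory Num.Theory.

(** * Quadratic reciprocity *)

Section QuadraticCharacter.
Variable F : finFieldType.
Hypothesis F_odd : odd #|F|.
Local Open Scope ring_scope.
Implicit Types x y : F.

(** Euler's criterion serves as the definition, which makes multiplicativity immediate; [qchar_eq1P]
    recovers the squares. *)
Definition qchar x : int :=
  if x == 0 then 0 else if x ^+ (#|F|.-1)./2 == 1 then 1 else -1.

Let halfK : ((#|F|.-1)./2).*2 = #|F|.-1.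
Proof.
rewrite -[RHS]odd_double_half; case: #|F| (ltnW (finNzRing_gt1 F)) F_odd =>
  //= n _.
by move/negbTE->.
Qed.

Lemma expf_pred_card x : x != 0 -> x ^+ #|F|.-1 = 1.
Proof.
move=> x0; apply: (mulfI x0); rewrite mulr1 -exprS prednK ?expf_card //.
exact: ltnW (finNzRing_gt1 F).
Qed.

Lemma half_exp_sqr x : x != 0 -> (x ^+ (#|F|.-1)./2) ^+ 2 = 1.
Proof. by move=> x0; rewrite -exprM muln2 halfK expf_pred_card. Qed.

Lemma two_neq0 : 2%:R != 0 :> F.
Proof.
apply/negP => /eqP two0.
have : (1 : F) *+ #|F| = 0.
  have /= := expg_cardG (finset.in_setT (1 : F) : (1 : F) \in [set: F]%G).
  by rewrite cardsT FinRing.zmodXgE.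
rewrite -[#|F|]odd_double_half F_odd -muln2 mulnC mulrnDr mulrnA two0 mul0rn
  addr0.
by apply/eqP/oner_neq0.
Qed.

Lemma one_neqN1 : (1 == -1 :> F) = false.
Proof. by rewrite -subr_eq0 opprK -(natrD _ 1 1); apply/negbTE/two_neq0. Qed.

Lemma qchar_half x : x ^+ (#|F|.-1)./2 = (qchar x)%:~R.
Proof.
rewrite /qchar; have [-> | x0] := eqVneq x 0.
  rewrite expr0n; case: eqP => // h; move: halfK (finNzRing_gt1 F) F_odd;
    rewrite h.
  by case: #|F| => [|[|[]]].
case: eqP => // /eqP x1; have /eqP := half_exp_sqr x0.
by rewrite sqrf_eq1 (negbTE x1) => /eqP ->.
Qed.

Lemma qchar_cases x : [\/ qchar x = 0, qchar x = 1 | qchar x = -1].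
Proof. by rewrite /qchar; do 2?case: ifP => _; constructor. Qed.

Lemma qchar_le1 x : (`|qchar x| <= 1)%N.
Proof. by case: (qchar_cases x) => ->. Qed.

(** The difference is at most 2 in absolute value, and 1 and 2 are nonzero in [F]. Hence identities
    between character values may be checked in [F]. *)
Lemma intr_le1_inj (a b : int) :
  (`|a| <= 1)%N -> (`|b| <= 1)%N -> a%:~R = b%:~R :> F -> a = b.
Proof.
move=> ha hb /eqP; rewrite -subr_eq0 -intrB => ab0; apply/eqP;
  rewrite -subr_eq0.
apply: contraTT ab0 => ab; suff : `|a - b|%:R != 0 :> F.
  by case: (a - b) => n //; rewrite NegzE rmorphN oppr_eq0.
suff /orP[] : (`|a - b| == 1)%N || (`|a - b| == 2)%N
  by move/eqP->; rewrite ?oner_eq0 ?two_neq0.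
by lia.
Qed.

Lemma qcharM x y : qchar (x * y) = qchar x * qchar y.
Proof.
apply: intr_le1_inj; rewrite ?qchar_le1 //; last
  by rewrite intrM -!qchar_half exprMn.
by rewrite abszM; case: (qchar_cases x) => ->; case: (qchar_cases y) => ->.
Qed.

Lemma qchar_eq0 x : (qchar x == 0) = (x == 0).
Proof. by rewrite /qchar; have [] := eqVneq x 0 => // _; case: ifP. Qed.

Lemma qchar_sqr x : x != 0 -> qchar (x ^+ 2) = 1.
Proof.
by move=> x0; rewrite /qchar sqrf_eq0 (negbTE x0) -exprM mul2n halfK
  expf_pred_card ?eqxx.
Qed.

Lemma qchar0 : qchar 0 = 0.
Proof. by rewrite /qchar eqxx. Qed.

Lemma qchar_eq1P x : reflect (x != 0 /\ exists y, x = y ^+ 2) (qchar x == 1).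
Proof.
apply: (iffP idP) => [|[x0 [y xy]]]; last first.
  by move: x0; rewrite xy sqrf_eq0 => y0; rewrite qchar_sqr.
rewrite /qchar; have [// | x0] := eqVneq x 0;
  have [x1 _ | //] := eqVneq (x ^+ _) 1; split=> //.
(* Write x as a power g^i of a generator of the unit group: the condition x^((n - 1)/2) = 1 forces i
   to be even. *)
have /cyclicP[g g_gen] := field_unit_group_cyclic [set: {unit F}]%G.
have xU : x \is a GRing.unit by rewrite unitfE.
have /cycleP[i xi] : FinRing.unit F xU \in <[g]>%g by rewrite -g_gen inE.
have og : #[g]%g = #|F|.-1 by rewrite /order -g_gen card_finField_unit.
have/eqP : (g ^+ (i * (#|F|.-1)./2) = 1)%g.
  by apply/val_inj; rewrite expgM -xi FinRing.val_unitX x1.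
rewrite -order_dvdn og -{1}halfK -muln2 mulnC dvdn_pmul2r; last first.
  have := finNzRing_gt1 F; move: halfK F_odd.
  by case: (_./2) => //; case: #|F| => [|[|[]]].
move=> /dvdnP[j ij]; exists (val (g ^+ j)%g).
by rewrite -[LHS]/(val (FinRing.unit F xU)) xi ij expgM /=.
Qed.

Lemma qchar_nonsquare x : qchar x = -1 <-> ~ exists y, x = y ^+ 2.
Proof.
split=> [xN1 [y xy] | xN].
  have [y0|y0] := eqVneq y 0; last by move: xN1; rewrite xy qchar_sqr.
  by move: xN1; rewrite xy y0 expr0n /qchar eqxx.
case: (qchar_cases x) => // [/eqP | /eqP/qchar_eq1P[_ //]].
by rewrite qchar_eq0 => /eqP x0; case: xN; exists 0; rewrite x0 expr0n.
Qed.

Lemma qcharN1 : qchar (-1) = (-1) ^+ (#|F|.-1)./2.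
Proof.
apply: intr_le1_inj; rewrite ?qchar_le1 ?abszX ?exp1n //.
by rewrite -qchar_half rmorphXn /= rmorphN.
Qed.

(** A nonsquare exists because squaring identifies 1 and -1, hence is not surjective. Multiplying
    the index by a nonsquare changes the sign of the sum. *)
Lemma sum_qchar : \sum_x qchar x = 0.
Proof.
have [x xN1] : exists x, qchar x = -1.
  case: (pickP (fun x => qchar x == -1)) => [x /eqP | no]; first by exists x.
  have sq x : x != 0 -> exists y, x = y ^+ 2.
    move=> x0; suff /eqP/qchar_eq1P[] : qchar x = 1 by [].
    case: (qchar_cases x) => //= /eqP; last by rewrite no.
    by rewrite qchar_eq0 (negbTE x0).
  have surj x : exists y, x == y ^+ 2.
    have [-> | /sq[y ->]] := eqVneq x 0; last by exists y.
    by exists 0; rewrite expr0n.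
  pose f x := xchoose (surj x).
  have fK : cancel f (fun y => y ^+ 2) by move=> x;
    rewrite -(eqP (xchooseP (surj x))).
  have := bij_can_bij (injF_bij (can_inj fK)) fK => /bij_inj inj2.
  by have /inj2/eqP := sqrrN (1 : F); rewrite eq_sym one_neqN1.
have x0 : x != 0 by rewrite -qchar_eq0 xN1.
suff : \sum_y qchar y = - \sum_y qchar y by lia.
rewrite {1}(reindex_inj (mulfI x0)) /= -sumrN.
by apply: eq_bigr => y _; rewrite qcharM xN1 mulN1r.
Qed.

End QuadraticCharacter.

Section QuadraticReciprocity.
Variables p q : nat.
Hypotheses (p_pr : prime p) (q_pr : prime q) (p_odd : odd p) (q_odd : odd q).
Hypothesis p_neq_q : p != q.
Local Open Scope ring_scope.

Let Fp_odd : odd #|'F_p|. Proof. by rewrite card_Fp. Qed.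
Let Fq_odd : odd #|'F_q|. Proof. by rewrite card_Fp. Qed.

(** The usual p* = (-1)^((p - 1)/2) p. *)
Let pstar : int := qchar (-1 : 'F_p) * p%:Z.

Section GaussSum.
Variables (K : fieldType) (z : K).
Hypotheses (z1 : z != 1) (zp : z ^+ p = 1).

Definition zchar (x : 'F_p) : K := z ^+ x.
Definition gauss_sum : K := \sum_x (qchar x)%:~R * zchar x.

Let expr_modp n : z ^+ (n %% p) = z ^+ n.
Proof. by rewrite [in RHS](divn_eq n p) exprD mulnC exprM zp expr1n mul1r. Qed.

Lemma zcharD x y : zchar (x + y) = zchar x * zchar y.
Proof.
rewrite /zchar -exprD -[in RHS]expr_modp; congr (_ ^+ _).
exact: (congr1 (modn (x + y)%N) (Fp_cast p_pr)).
Qed.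

Lemma zchar0 : zchar 0 = 1. Proof. by []. Qed.

Lemma zchar1 : zchar 1 = z.
Proof. by rewrite /zchar (val_Fp_nat p_pr 1) modn_small ?prime_gt1. Qed.

Lemma zcharMn x n : zchar (x *+ n) = zchar x ^+ n.
Proof. by elim: n => [|n IH]; rewrite ?mulrS ?zcharD ?IH ?exprS. Qed.

Lemma sum_zchar : \sum_x zchar x = 0.
Proof.
have : z * \sum_x zchar x = \sum_x zchar x.
  rewrite mulr_sumr [in RHS](reindex_inj (addrI 1)) /=.
  by apply: eq_bigr => x _; rewrite zcharD zchar1.
move/eqP; rewrite -subr_eq0 -[X in _ - X]mul1r -mulrBl mulf_eq0 subr_eq0.
by rewrite (negbTE z1) => /eqP.
Qed.

Lemma sum_zcharM (a : 'F_p) : \sum_(x | x != 0) zchar (x * a) =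
  if a == 0 then p%:R - 1 else -1.
Proof.
have : \sum_x zchar (x * a) = if a == 0 then p%:R else 0.
  have [-> | a0] := eqVneq.
    under eq_bigr do rewrite mulr0 zchar0.
    by rewrite sumr_const card_Fp.
  by rewrite -[RHS]sum_zchar [RHS](reindex_inj (mulIf a0)).
rewrite (bigD1 0) //= mul0r zchar0 => /(canRL (addKr _)) ->.
by case: ifP => _; rewrite addrC ?add0r.
Qed.

(** Replacing the second index by x y turns the product into a sum of [qchar y] z^(x (1 + y)). The
    sum over nonzero x is p - 1 for y = -1 and -1 otherwise, and the character values add up to
    0. *)
Lemma gauss_sum_sqr : gauss_sum ^+ 2 = pstar%:~R.
Proof.
have term (x y : 'F_p) : x != 0 ->
    (qchar x)%:~R * zchar x * ((qchar (x * y))%:~R * zchar (x * y)) =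
    (qchar y)%:~R * zchar (x * (1 + y)) :> K.
  move=> x0; rewrite mulrDr mulr1 zcharD qcharM // intrM.
  have : (qchar x)%:~R * (qchar x)%:~R = 1 :> K.
    by rewrite -intrM -qcharM // -expr2 qchar_sqr.
  by move=> h; ring: h.
rewrite expr2 {1}/gauss_sum (bigD1 0) //= qchar0 mul0r add0r.
transitivity (\sum_(x : 'F_p | x != 0) \sum_y (qchar y)%:~R * zchar
  (x * (1 + y))).
  rewrite mulr_suml; apply: eq_bigr => x x0.
  rewrite /gauss_sum (reindex_inj (mulfI x0)) mulr_sumr.
  by apply: eq_bigr => y _; rewrite -term.
rewrite exchange_big /=.
under eq_bigr do rewrite -mulr_sumr sum_zcharM.
have -> : pstar%:~R = (\sum_(y : 'F_p) (if 1 +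
  y == 0 then qchar y * p%:Z else 0 : int))%:~R
                      - (\sum_(y : 'F_p) qchar y)%:~R :> K.
  rewrite sum_qchar // subr0; congr _%:~R.
  rewrite (bigD1 (-1)) //= subrr eqxx big1 ?addr0 // => y yN1.
  by rewrite addrC addr_eq0 (negbTE yN1).
rewrite -intrB -sumrB raddf_sum /=; apply: eq_bigr => y _; case: ifP => _.
  by rewrite intrB intrM; ring.
by rewrite sub0r intrN mulrN1.
Qed.

(** The q-th power is additive here and fixes the character values as q is odd, so it only replaces
    z^x by z^(q x); reindexing by q x brings out the factor [qchar q]. *)
Lemma gauss_sum_frob : q \in [pchar K] ->
  gauss_sum ^+ q = (qchar (q%:R : 'F_p))%:~R * gauss_sum.
Proof.
move=> qK; have qp0 : q%:R != 0 :> 'F_p.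
  by rewrite -(dvdn_pcharf (pchar_Fp p_pr)) dvdn_prime2.
rewrite -(pFrobenius_autE qK) /gauss_sum rmorph_sum /=.
rewrite [in RHS](reindex_inj (mulfI qp0)) mulr_sumr.
apply: eq_bigr => x _; rewrite rmorphM /= !pFrobenius_autE -zcharMn
  -(mulr_natl x q).
rewrite qcharM //. rewrite mulrA -intrM mulrA -expr2.
have -> : qchar (q%:R : 'F_p) ^+ 2 = 1
  by rewrite expr2 -qcharM // -expr2 qchar_sqr.
rewrite mul1r -rmorphXn; congr (_%:~R * _).
by case: (qchar_cases x) => ->;
  rewrite ?expr1n ?expr0n ?(gtn_eqF (prime_gt0 _)) -1?signr_odd ?q_odd.
Qed.

End GaussSum.

(** [z] is a root of the cyclotomic polynomial [P]; it is not 1 because P(1) = p is nonzero in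
    characteristic q. *)
Lemma root_of_unity_in_char :
  exists (K : fieldType) (f : {rmorphism 'F_q -> K}) (z : K), z != 1 /\
    z ^+ p = 1.
Proof.
have [K [f _]] := countable_algebraic_closure 'F_q; exists K, f.
have qK : q \in [pchar K] by rewrite (fmorph_pchar f) pchar_Fp.
pose P : {poly K} := \sum_(i < p) 'X^i.
have PE : 'X^p - 1%:P = ('X - 1%:P) * P by rewrite polyC1 subrX1.
have P1 : P.[1] = p%:R.
  rewrite horner_sum; under eq_bigr do rewrite hornerXn expr1n.
  by rewrite sumr_const card_ord.
have sP : size P = p.
  have p0 := prime_gt0 p_pr; have P0 : P != 0.
    apply/eqP => P0; have := size_XnsubC (1 : K) p0.
    by rewrite PE P0 mulr0 size_poly0.
  apply/eqP; rewrite -eqSS -(size_XnsubC (1 : K) p0) PE.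
  by rewrite size_monicM ?monicXsubC // size_XsubC.
have /closed_rootP[z Pz] : size P != 1 by rewrite sP;
  case: (p) (prime_gt1 p_pr) => [|[]].
exists z; split.
  apply: contraTneq Pz => ->; rewrite /root P1 -(dvdn_pcharf qK) dvdn_prime2 //.
  by rewrite eq_sym.
have := congr1 (horner^~ z) PE; rewrite hornerM (rootP Pz) mulr0 !hornerE.
by move/eqP; rewrite subr_eq0 => /eqP.
Qed.

(* Both sides say that the Gauss sum lies in the prime field. *)
Theorem quadratic_reciprocity :
  qchar (pstar%:~R : 'F_q) = qchar (q%:R : 'F_p).
Proof.
have [K [f [z [z1 zp]]]] := root_of_unity_in_char.
have qK : q \in [pchar K] by rewrite (fmorph_pchar f) pchar_Fp.
pose g := gauss_sum z; have g2 : g ^+ 2 = pstar%:~R := gauss_sum_sqr z1 zp.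
have gq : g ^+ q = _ := gauss_sum_frob zp qK.
have ps0 : pstar%:~R != 0 :> K.
  rewrite /pstar intrM mulf_neq0 //;
    last by rewrite -(dvdn_pcharf qK) dvdn_prime2 // eq_sym.
  case: (qchar_cases (-1 : 'F_p)) => [/eqP|->|->];
    rewrite ?oner_eq0 ?oppr_eq0 ?oner_eq0 //.
  by rewrite qchar_eq0 oppr_eq0 oner_eq0.
have g0 : g != 0 by apply: contraNneq ps0 => g0; rewrite -g2 g0 expr0n.
have : g ^+ q.-1 = (qchar (q%:R : 'F_p))%:~R.
  by apply: (mulIf g0); rewrite -exprSr prednK ?prime_gt0.
have -> : q.-1 = (q.-1./2 * 2)%N.
  by rewrite muln2 -[LHS]odd_double_half; case: (q) q_odd => //= n /negbTE->.
rewrite mulnC exprM g2 -(rmorph_int f) -rmorphXn -(rmorph_int f) => /fmorph_inj.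
have := qchar_half Fq_odd pstar%:~R; rewrite card_Fp // => -> /intr_le1_inj;
  apply=> //;
  exact: qchar_le1.
Qed.

End QuadraticReciprocity.

(** * Legendre's theorem *)

Section Legendre.
Variable p : nat.
Hypotheses (p_pr : prime p) (p_odd : odd p).
Local Open Scope ring_scope.

Let Fp_odd : odd #|'F_p|. Proof. by rewrite card_Fp. Qed.

Lemma Fp_dvdz (n : int) : (n%:~R == 0 :> 'F_p) = (p %| n)%Z.
Proof. by rewrite -(dvdz_pcharf (pchar_Fp p_pr)). Qed.

Lemma legendreE (n : int) : legendre n p = qchar (n%:~R : 'F_p).
Proof.
rewrite /legendre -Fp_dvdz; have [/eqP | n0] := eqVneq (n%:~R : 'F_p) 0.
  by rewrite -(qchar_eq0 (n%:~R : 'F_p)) => /eqP ->.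
have sqE (x : int) : ((x ^+ 2 == n %[mod p])%Z) =
  ((n%:~R : 'F_p) == x%:~R ^+ 2).
  by rewrite eqz_mod_dvd -Fp_dvdz intrB rmorphXn subr_eq0 eq_sym.
case: existsP => [[x] | no].
  by rewrite sqE => /eqP nx; symmetry; apply/eqP/(qchar_eq1P Fp_odd); split;
    last by exists x%:~R.
symmetry; apply/(qchar_nonsquare Fp_odd) => -[y ny]; apply: no.
have yp : (y < p)%N by rewrite -[X in (_ < X)%N](Fp_cast p_pr).
exists (Ordinal yp); rewrite sqE ny /=; apply/eqP; congr (_ ^+ _).
by rewrite -pmulrn; apply/val_inj; rewrite /= val_Fp_nat // modn_small.
Qed.

Lemma legendreM (m n : int) : legendre (m * n) p = legendre m p * legendre n p.
Proof. by rewrite !legendreE intrM qcharM. Qed.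

Lemma legendre_cases (n : int) : [\/ legendre n p = 0,
  legendre n p = 1 | legendre n p = -1].
Proof. by rewrite legendreE; apply: qchar_cases. Qed.

Lemma legendre_eq0 (n : int) : (legendre n p == 0) = (p %| n)%Z.
Proof. by rewrite legendreE qchar_eq0 Fp_dvdz. Qed.

Lemma legendreN1 : legendre (-1) p = if (p %% 4 == 1)%N then 1 else -1.
Proof.
rewrite legendreE rmorphN1 qcharN1 // card_Fp // -signr_odd.
case: (boolP (odd _)) => o; case: eqP => //; lia.
Qed.

Lemma legendre_eq1_sqrt (n : int) : legendre n p = 1 ->
  exists r : int, (p %| r ^+ 2 - n)%Z.
Proof.
rewrite legendreE => /eqP/(qchar_eq1P Fp_odd)[_ [y ny]].
exists (y : nat)%:Z; rewrite -Fp_dvdz intrB rmorphXn ny /= subr_eq0; apply/eqP.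
by congr (_ ^+ _); rewrite -pmulrn natr_Zp.
Qed.

Lemma legendre_sqr (n : int) : ~~ (p %| n)%Z -> legendre (n ^+ 2) p = 1.
Proof. by rewrite -legendre_eq0 expr2 legendreM;
  case: (legendre_cases n) => ->. Qed.

Lemma legendre_congr (m n : int) : (p %| m - n)%Z ->
  legendre m p = legendre n p.
Proof. by rewrite !legendreE -Fp_dvdz intrB subr_eq0 => /eqP->. Qed.

(** Otherwise x / y would be a square root of n modulo p. *)
Lemma legendreN1_anisotropic (n x y : int) :
  legendre n p = -1 -> (p %| x ^+ 2 - n * y ^+ 2)%Z -> (p %| x)%Z /\ (p %| y)%Z.
Proof.
move=> nN1 pxy; have pp (z : int) : (p %| z ^+ 2)%Z = (p %| z)%Z.
  by rewrite -!legendre_eq0 expr2 legendreM mulf_eq0 orbb.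
have py : (p %| y)%Z.
  apply: contraT => py; have := legendre_congr pxy.
  rewrite legendreM nN1 (legendre_sqr py) expr2 legendreM.
  by case: (legendre_cases x) => ->.
split=> //; rewrite -pp -(subrK (n * y ^+ 2) (x ^+ 2)) rpredD ?pxy //.
by rewrite expr2 mulrA dvdz_mull.
Qed.
End Legendre.

Section Reciprocity.
Variables p q : nat.
Hypotheses (p_pr : prime p) (q_pr : prime q) (p_odd : odd p) (q_odd : odd q).
Hypothesis p_neq_q : p != q.
Local Open Scope ring_scope.

Lemma legendre_reciprocity1 : (p %% 4 = 1)%N -> legendre p q = legendre q p.
Proof.
move=> p1; have := quadratic_reciprocity p_pr q_pr p_odd q_odd p_neq_q.
have := legendreN1 p_pr p_odd; rewrite p1 !legendreE // rmorphN1 => ->.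
by rewrite mul1r.
Qed.

Lemma legendre_reciprocity3 : (p %% 4 = 3)%N ->
  legendre (- p%:Z) q = legendre q p.
Proof.
move=> p1; have := quadratic_reciprocity p_pr q_pr p_odd q_odd p_neq_q.
have := legendreN1 p_pr p_odd; rewrite p1 !legendreE // rmorphN1 => ->.
by rewrite mulN1r.
Qed.
End Reciprocity.

(** * Sums of two squares and rational points on conics, by the pigeonhole principle *)

Section SmallSolutions.
Local Open Scope ring_scope.

Lemma pigeonhole (T S : finType) (f : T -> S) :
  (#|S| < #|T|)%N -> exists x y, x != y /\ f x = f y.
Proof.
move=> lt; have : ~~ injectiveb f.
  by apply/injectiveP => /leq_card; rewrite leqNgt lt.
move=> /injectivePn[x [y xy fxy]]; by exists x, y.
Qed.

Lemma dvdz_sub_of_modz (p : nat) (m n : int) : (0 < p)%N ->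
  `|(m %% p)%Z| = `|(n %% p)%Z| %[mod p] -> (p %| m - n)%Z.
Proof.
move=> p0 h; rewrite -eqz_mod_dvd; apply/eqP.
have pp : 0 < p%:Z by lia.
have pz : p%:Z != 0 by lia.
move: h (ltz_pmod m pp) (ltz_pmod n pp) (modz_ge0 m pz) (modz_ge0 n pz).
move: (m %% p)%Z (n %% p)%Z => a b h *.
by move: h; rewrite !modn_small; lia.
Qed.

Lemma exists_sqrt_floor (n : nat) : exists m : nat, (m ^ 2 <= n < m.+1 ^ 2)%N.
Proof.
elim: n => [|n [m /andP[h1 h2]]]; first by exists 0%N.
have [lt | ge] := ltnP n.+1 (m.+1 ^ 2); first by exists m;
  rewrite lt andbT leqW.
exists m.+1; rewrite ge /=; apply: leq_ltn_trans h2 _; by rewrite ltn_sqr.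
Qed.

Lemma ord_diff_sqr m (i j : 'I_m.+1) : ((i : nat)%:Z - (j : nat)%:Z) ^+ 2 <=
  (m ^ 2)%N%:Z.
Proof.
have := ltn_ord i; have := ltn_ord j; set d := _%:Z - _; rewrite !ltnS => jm im.
have -> : (m ^ 2)%N%:Z = m%:Z ^+ 2 by rewrite expnS expn1 PoszM expr2.
rewrite -subr_ge0 subr_sqr mulr_ge0 // /d; lia.
Qed.

(** Thue's argument: with r^2 = -1 modulo p, more than p pairs (x, y) have coordinates at most sqrt
    p, so two of them agree under x - r y. Their difference has x^2 + y^2 divisible by p and
    strictly between 0 and 2p. *)
Lemma prime_sum_two_squares (p : nat) : prime p -> (p %% 4 = 1)%N ->
  exists a b : int, p%:Z = a ^+ 2 + b ^+ 2.
Proof.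
move=> p_pr p1; have p_odd : odd p by lia.
have p0 := prime_gt0 p_pr.
have [r pr] : exists r : int, (p %| r ^+ 2 - -1)%Z.
  by apply: legendre_eq1_sqrt => //; rewrite legendreN1 // p1.
have [m /andP[mp pm]] := exists_sqrt_floor p.
pose f (t : 'I_m.+1 * 'I_m.+1) : 'I_p :=
  Ordinal (ltn_pmod `|(((t.1 : nat)%:Z - r * (t.2 : nat)%:Z) %% p)%Z|%N p0).
have [[x1 y1] [[x2 y2] []]] : exists t u, t != u /\ f t = f u.
  by apply: pigeonhole; rewrite card_prod !card_ord mulnn.
move=> neq /(congr1 val) /(dvdz_sub_of_modz p0) /=.
set x := (x1 : nat)%:Z - (x2 : nat)%:Z; set y := (y1 : nat)%:Z - (y2 : nat)%:Z.
have -> : (x1 : nat)%:Z - r * (y1 : nat)%:Z -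
  ((x2 : nat)%:Z - r * (y2 : nat)%:Z) = x - r * y.
  by rewrite /x /y; ring.
move=> dv; have xy0 : (x, y) != (0, 0).
  apply: contraNneq neq => -[/eqP]; rewrite subr_eq0 => /eqP[ex] /eqP.
  by rewrite subr_eq0 => /eqP[ey]; rewrite xpair_eqE -!val_eqE /= ex ey !eqxx.
have dv2 : (p %| x ^+ 2 + y ^+ 2)%Z.
  have -> : x ^+ 2 + y ^+ 2 = (x - r * y) * (x + r * y) +
    (r ^+ 2 - -1) * y ^+ 2 by ring.
  by rewrite rpredD ?dvdz_mulr.
have mp' : (m ^ 2 < p)%N.
  rewrite ltn_neqAle mp andbT; apply: contraTneq p_pr => <-.
  by rewrite expnS expn1; case: (m) => [|[|k]] //; apply/primePn; right;
     exists k.+2; rewrite ?dvdn_mulr //; lia.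
have [hx hy] : x ^+ 2 <= (m ^ 2)%N%:Z /\ y ^+ 2 <= (m ^ 2)%N%:Z by split;
  apply: ord_diff_sqr.
have pos : 0 < x ^+ 2 + y ^+ 2.
  rewrite lt_neqAle addr_ge0 ?sqr_ge0 // andbT eq_sym paddr_eq0 ?sqr_ge0 //.
  by rewrite !sqrf_eq0; apply: contraNN xy0 => /andP[/eqP-> /eqP->].
move: dv2 => /dvdzP[k hk]; exists x, y; rewrite hk.
suff -> : k = 1 by rewrite mul1r.
have mpz : (m ^ 2)%N%:Z < p by rewrite ltz_nat.
have : k * p < 2 * p%:Z.
  by rewrite -hk mulrDl mul1r ltrD ?(le_lt_trans hx) ?(le_lt_trans hy).
have : 0 * p%:Z < k * p by rewrite mul0r -hk.
by rewrite !ltr_pM2r; lia.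
Qed.
(** Makes the bounds on the box in [legendre_conic] strict. *)
Lemma sqr_neq_mul_primes (a b m : nat) : prime a -> prime b -> a != b ->
  (m ^ 2 != a * b)%N.
Proof.
move=> a_pr b_pr ab; apply/eqP => e.
have am : (a %| m)%N.
  by have := dvdn_mulr b (dvdnn a); rewrite -e Euclid_dvdX // andbT.
have : (a ^ 2 %| a * b)%N by rewrite -e dvdn_exp2r.
rewrite expnS expn1 dvdn_pmul2l ?prime_gt0 // dvdn_prime2 //.
by rewrite (negbTE ab).
Qed.

Lemma coprimez_prime (a b : nat) : prime a -> prime b -> a != b -> coprimez a b.
Proof. by move=> a_pr b_pr ab; rewrite coprimezE !absz_nat prime_coprime //
  dvdn_prime2. Qed.

(* A pigeonhole argument in the lattice where the form is divisible by [a b c]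
   produces a small vector, at which the form is [0] or [a b c]; the second case
   is turned into the first by an identity. *)
Theorem legendre_conic (a b c : nat) :
  prime a -> prime b -> prime c -> a != b -> b != c -> a != c ->
  odd a -> odd b -> odd c ->
  legendre (b%:Z * c%:Z) a = 1 -> legendre (a%:Z * c%:Z) b = 1 ->
  legendre (- (a%:Z * b%:Z)) c = 1 ->
  exists x y z : int, (x, y, z) != (0, 0, 0) /\
    a%:Z * x ^+ 2 + b%:Z * y ^+ 2 = c%:Z * z ^+ 2.
Proof.
move=> a_pr b_pr c_pr ab bc ac a_odd b_odd c_odd.
move=> /(legendre_eq1_sqrt a_pr a_odd)[r1 h1]
  /(legendre_eq1_sqrt b_pr b_odd)[r2 h2].
move=> /(legendre_eq1_sqrt c_pr c_odd)[r3 h3].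
have [[a0 b0] c0] := (prime_gt0 a_pr, prime_gt0 b_pr, prime_gt0 c_pr).
have [mx /andP[mx1 mx2]] := exists_sqrt_floor (b * c).
have [my /andP[my1 my2]] := exists_sqrt_floor (a * c).
have [mz /andP[mz1 mz2]] := exists_sqrt_floor (a * b).
have {}mx1 : (mx ^ 2 < b * c)%N by rewrite ltn_neqAle mx1 sqr_neq_mul_primes.
have {}my1 : (my ^ 2 < a * c)%N by rewrite ltn_neqAle my1 sqr_neq_mul_primes.
have {}mz1 : (mz ^ 2 < a * b)%N by rewrite ltn_neqAle mz1 sqr_neq_mul_primes.
pose n2z n (i : 'I_n) : int := (i : nat)%:Z.
pose f (t : 'I_mx.+1 * 'I_my.+1 * 'I_mz.+1) : 'I_a * 'I_b * 'I_c :=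
  let x := n2z _ t.1.1 in let y := n2z _ t.1.2 in let z := n2z _ t.2 in
  (Ordinal (ltn_pmod `|((b%:Z * y - r1 * z) %% a)%Z|%N a0),
   Ordinal (ltn_pmod `|((c%:Z * z - r2 * x) %% b)%Z|%N b0),
   Ordinal (ltn_pmod `|((a%:Z * x - r3 * y) %% c)%Z|%N c0)).
have [[[x1 y1] z1] [[[x2 y2] z2] []]] : exists t u, t != u /\ f t = f u.
  (* The box has more than abc points, since the product of bc, ac and ab is the square of abc. *)
  apply: pigeonhole; rewrite !card_prod !card_ord -ltn_sqr !expnMn.
  have e : (a ^ 2 * b ^ 2 * c ^ 2 = (b * c) * (a * c) * (a * b))%N by ring.
  by rewrite e; apply: ltn_mul mz2; apply: ltn_mul.
move=> neq; rewrite /f /= => -[/(dvdz_sub_of_modz a0) +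
  /(dvdz_sub_of_modz b0) + /(dvdz_sub_of_modz c0)].
set x := n2z _ x1 - n2z _ x2; set y := n2z _ y1 - n2z _ y2;
  set z := n2z _ z1 - n2z _ z2.
have -> : b%:Z * n2z _ y1 - r1 * n2z _ z1 - (b%:Z * n2z _ y2 - r1 * n2z _ z2) =
  b%:Z * y - r1 * z.
  by rewrite /y /z; ring.
have -> : c%:Z * n2z _ z1 - r2 * n2z _ x1 - (c%:Z * n2z _ z2 - r2 * n2z _ x2) =
  c%:Z * z - r2 * x.
  by rewrite /x /z; ring.
have -> : a%:Z * n2z _ x1 - r3 * n2z _ y1 - (a%:Z * n2z _ x2 - r3 * n2z _ y2) =
  a%:Z * x - r3 * y.
  by rewrite /x /y; ring.
move=> d1 d2 d3.
have xyz0 : (x, y, z) != (0, 0, 0).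
  apply: contraNneq neq => -[/eqP]; rewrite subr_eq0 => /eqP[ex] /eqP.
  rewrite subr_eq0 => /eqP[ey] /eqP; rewrite subr_eq0 => /eqP[ez].
  by rewrite !xpair_eqE -!val_eqE /= ex ey ez !eqxx.
pose V := a%:Z * x ^+ 2 + b%:Z * y ^+ 2 - c%:Z * z ^+ 2.
have aV : (a %| V)%Z.
  rewrite -(Gauss_dvdzr _ (coprimez_prime a_pr b_pr ab)).
  have -> : b%:Z * V = (b%:Z * y - r1 * z) * (b%:Z * y + r1 * z) +
    (r1 ^+ 2 - b%:Z * c%:Z) * z ^+ 2
      + a%:Z * (b%:Z * x ^+ 2) by rewrite /V; ring.
  by rewrite !rpredD ?dvdz_mulr.
have bV : (b %| V)%Z.
  rewrite -(Gauss_dvdzr _ (coprimez_prime b_pr c_pr bc)).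
  have -> : c%:Z * V = (c%:Z * z - r2 * x) * - (c%:Z * z + r2 * x) +
    (r2 ^+ 2 - a%:Z * c%:Z) * - x ^+ 2
      + b%:Z * (c%:Z * y ^+ 2) by rewrite /V; ring.
  by rewrite !rpredD ?dvdz_mulr.
have cV : (c %| V)%Z.
  rewrite eq_sym in ac; rewrite -(Gauss_dvdzr _ (coprimez_prime c_pr a_pr ac)).
  have -> : a%:Z * V = (a%:Z * x - r3 * y) * (a%:Z * x + r3 * y) +
    (r3 ^+ 2 - - (a%:Z * b%:Z)) * y ^+ 2
      + c%:Z * - (a%:Z * z ^+ 2) by rewrite /V; ring.
  by rewrite !rpredD ?dvdz_mulr.
have abcV : (a%:Z * b%:Z * c%:Z %| V)%Z.
  rewrite Gauss_dvdz ?Gauss_dvdz ?aV ?bV ?cV ?coprimezMl ?coprimez_prime //.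
have hx : x ^+ 2 < b%:Z * c%:Z by apply: le_lt_trans (ord_diff_sqr _ _) _;
  rewrite -PoszM ltz_nat.
have hy : y ^+ 2 < a%:Z * c%:Z by apply: le_lt_trans (ord_diff_sqr _ _) _;
  rewrite -PoszM ltz_nat.
have hz : z ^+ 2 < a%:Z * b%:Z by apply: le_lt_trans (ord_diff_sqr _ _) _;
  rewrite -PoszM ltz_nat.
have [k Vk] : exists k, V = k * (a%:Z * b%:Z * c%:Z) by apply/dvdzP.
have [az bz cz] : [/\ 0 < a%:Z, 0 < b%:Z & 0 < c%:Z] by rewrite !ltz_nat.
pose D := a%:Z * b%:Z * c%:Z; have D0 : 0 < D by rewrite !mulr_gt0.
have e1 : a%:Z * x ^+ 2 < D by rewrite /D -mulrA ltr_pM2l.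
have e2 : b%:Z * y ^+ 2 < D.
  have -> : D = b%:Z * (a%:Z * c%:Z) by rewrite /D; ring.
  by rewrite ltr_pM2l.
have e3 : c%:Z * z ^+ 2 < D by rewrite /D [X in _ < X]mulrC ltr_pM2l.
have [f1 f2 f3] : [/\ 0 <= a%:Z * x ^+ 2, 0 <= b%:Z * y ^+ 2 & 0 <=
  c%:Z * z ^+ 2].
  by split; rewrite mulr_ge0 ?sqr_ge0 // ltW.
(* Each of the three terms of V lies in [0, abc), so V is strictly between -abc and 2abc. *)
have [Vgt Vlt] : (-1) * D < k * D /\ k * D < 2 * D.
  rewrite -Vk /V; move: D0 e1 e2 e3 f1 f2 f3.
  move: D (a%:Z * _) (b%:Z * _) (c%:Z * _) => {}D X Y Z; clear; lia.
have k01 : k = 0 \/ k = 1.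
  by move: Vlt Vgt; rewrite !ltr_pM2r //; clear; lia.
case: k01 Vk => -> Vk; first by exists x, y, z; split=> //; move: Vk;
  rewrite mul0r; apply: subr0_eq.
(* Now a x^2 + b y^2 = c (z^2 + ab). By Brahmagupta's identity the left side times z^2 + ab is again
   of the form a X^2 + b Y^2, and it equals c (z^2 + ab)^2. The last coordinate is positive. *)
exists (x * z + b%:Z * y), (y * z - a%:Z * x), (z ^+ 2 + a%:Z * b%:Z); split.
  apply/negP => /eqP[_ _]; apply/eqP/lt0r_neq0;
    rewrite ltr_wpDl ?sqr_ge0 ?mulr_gt0 //.
have {}Vk : a%:Z * x ^+ 2 + b%:Z * y ^+ 2 = c%:Z * (z ^+ 2 + a%:Z * b%:Z).
  by move/eqP: Vk; rewrite /V mul1r subr_eq => /eqP ->; ring.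
transitivity ((a%:Z * x ^+ 2 + b%:Z * y ^+ 2) * (z ^+ 2 + a%:Z * b%:Z));
  first by ring.
by rewrite Vk; ring.
Qed.

End SmallSolutions.

(** * Imaginary quadratic fields *)

Section AlgebraicIntegers.
Variable K : fieldType.
Local Open Scope ring_scope.
Local Open Scope classical_set_scope.
Implicit Types x y : K.

Lemma integers_int (n : int) : @integers K n%:~R.
Proof. exact: integral_id. Qed.

Lemma integers_nat (n : nat) : @integers K n%:R.
Proof. exact: integral_nat. Qed.

Lemma integers0 : @integers K 0. Proof. exact: (integers_nat 0). Qed.
Lemma integers1 : @integers K 1. Proof. exact: (integers_nat 1). Qed.

Lemma integersN x : integers x -> integers (- x).
Proof. exact: integral_opp. Qed.

Lemma integersD x y : integers x -> integers y -> integers (x + y).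
Proof. exact: integral_add. Qed.

Lemma integersB x y : integers x -> integers y -> integers (x - y).
Proof. exact: integral_sub. Qed.

Lemma integersM x y : integers x -> integers y -> integers (x * y).
Proof. exact: integral_mul. Qed.

Lemma integersX x n : integers x -> integers (x ^+ n).
Proof.
by move=> Ix; elim: n => [|n IH];
  [apply: integers1 | rewrite exprS; apply: integersM].
Qed.

Lemma integers_sum (I : Type) (r : seq I) (P : pred I) (f : I -> K) :
  (forall i, P i -> integers (f i)) -> integers (\sum_(i <- r | P i) f i).
Proof. by move=> If; elim/big_ind: _ => //;
  [apply: integers0 | apply: integersD]. Qed.

Lemma integers_sqrt x : integers (x ^+ 2) -> integers x.
Proof.
move=> Ix2; apply: (@integral_root_monic _ _ _ _ ('X^2 - (x ^+ 2)%:P)).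
- exact: monicXnsubC.
- by rewrite /root !hornerE subrr.
apply/integral_poly => i; rewrite coefB coefXn coefC.
by apply: integersB; [case: eqP => _;
  [apply: integers1|apply: integers0]|case: ifP => // _; apply: integers0].
Qed.

Lemma integers_root2 x (t n : K) :
  integers t -> integers n -> x ^+ 2 - t * x + n = 0 -> integers x.
Proof.
move=> It In xE; apply: (@integral_root_monic _ _ _ _
  ('X^2 + (- t *: 'X + n%:P))).
- rewrite monicE lead_coefDl ?lead_coefXn // size_polyXn ltnS.
  rewrite (leq_trans (size_polyD _ _)) // geq_max
    (leq_trans (size_scale_leq _ _)) ?size_polyX //.
  by rewrite (leq_trans (size_polyC_leq1 _)).
- by rewrite /root !hornerE -xE mulNr ?addrA.
apply/integral_poly => i; rewrite !coefD coefZ coefXn coefX coefC.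
apply: integersD; first by case: eqP => _; [apply: integers1|apply: integers0].
apply: integersD; last by case: ifP => // _; apply: integers0.
apply: integersM; first exact: integersN.
by case: eqP => _; [apply: integers1|apply: integers0].
Qed.

Lemma submodule_integers : is_submodule (@integers K).
Proof. by split; [apply: integers0 | apply: integersD | apply: integersM]. Qed.

End AlgebraicIntegers.

Section IntegersExtension.
Local Open Scope ring_scope.

Lemma integers_in_alg (F : fieldType) (L : fieldExtType F) (x : F) :
  integers (x%:A : L) <-> integers x.
Proof.
have int_alg : in_alg L \o intr =1 (intr : int -> L)
  by exact: (rmorph_int (in_alg L)).
split=> -[p p_mon pr]; exists p => //; move: pr;
  rewrite -(eq_map_poly int_alg) map_poly_comp.
  by rewrite fmorph_root.
by move=> pr; rewrite fmorph_root.
Qed.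

Lemma rat_integers (a : rat) : @integers rat a -> a \is a Num.int.
Proof.
case=> p p_mon pr; have : (ratr a : algC) \in Aint.
  apply: (@root_monic_Aint (map_poly intr p)).
  - have int_ratr : (ratr : rat -> algC) \o intr =1 intr by move=> n /=;
    rewrite ratr_int.
    by rewrite -(eq_map_poly int_ratr) map_poly_comp fmorph_root.
  - exact: monic_map.
  - by apply/polyOverP => i; rewrite coef_map /= intr_int.
move/(Cint_rat_Aint (Crat_rat a)) => /intrP[m am].
suff -> : a = m%:~R by exact: intr_int.
by apply: (fmorph_inj (ratr : {rmorphism rat -> algC})); rewrite /= am ratr_int.
Qed.

(* The powers of a non-integer have unbounded denominators. *)
Lemma rat_almost_integral (m a : rat) :
  m != 0 -> (forall n, m * a ^+ n \is a Num.int) -> a \is a Num.int.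
Proof.
move=> m0 h; have := h 0%N; rewrite expr0 mulr1 => /intrP[k mk].
have k0 : k != 0 by apply: contraNneq m0 => k0; rewrite mk k0.
rewrite Qint_def; have dn n : (`|denq a| ^ n %| `|k|)%N.
  have /intrP[j kj] := h n; rewrite mk in kj.
  have e : k * numq a ^+ n = j * denq a ^+ n.
    by apply: (@intr_inj rat); rewrite !intrM !rmorphXn /= numqE exprMn -kj
      mulrA.
  rewrite -(@Gauss_dvdl _ _ (`|numq a| ^ n)); last first.
    by rewrite coprime_sym coprimeXl // coprimeXr // coprime_num_den.
  by rewrite -!abszX -abszM e abszM dvdn_mull.
have : (`|denq a| <= 1)%N.
  rewrite leqNgt; apply/negP => gt1; have := dvdn_leq _ (dn `|k|%N).
  by rewrite absz_gt0 k0 leqNgt ltn_expl // => /(_ isT).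
by have := denq_gt0 a; move: (denq a) => D; lia.
Qed.

End IntegersExtension.

(* A copy of [in_alg F]: rewriting with morphism lemmas fails on [in_alg F],
   where [rat] can be reached through several structures. *)
Definition rat_alg (F : fieldExtType rat) : rat -> F := fun a => (a%:A)%R.
HB.instance Definition _ (F : fieldExtType rat) :=
  GRing.RMorphism.copy (@rat_alg F) (in_alg F).

(** * Conjugation, trace, norm and integers of an imaginary quadratic field *)

Section QuadraticField.
Variables (F : fieldExtType rat) (s : F) (d : int).
Local Open Scope ring_scope.
Local Open Scope classical_set_scope.
Hypotheses (s_sqrt : s ^+ 2 = d%:~R) (F_gen : <<1;
  s>>%VS = {:F}%VS) (d_neg : d < 0).
Implicit Types (x y : F) (a b : rat).

Local Notation "a %:E" := (rat_alg F a) : ring_scope.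

Let s2 : s ^+ 2 = (d%:~R)%:E. Proof. by rewrite rmorph_int. Qed.

Lemma quad_coords x : exists ab : rat * rat, x == ab.1%:E + ab.2%:E * s.
Proof.
have : x \in <<1; s>>%VS by rewrite F_gen memvf.
move/Fadjoin1_polyP => [P ->]; elim/poly_ind: P => [|P c [[a b] /eqP IH]].
  by exists (0, 0); rewrite rmorph0 horner0 /fst rmorph0 mul0r addr0.
exists (c + b * d%:~R, a).
have -> : map_poly (rat_alg F) (P * 'X + c%:P) = map_poly (rat_alg F) P * 'X +
  (c%:E)%:P.
  by rewrite rmorphD rmorphM /= map_polyX map_polyC.
rewrite hornerD hornerM hornerX hornerC IH /fst /snd mulrDl -mulrA -expr2 s2.
by rewrite rmorphD rmorphM addrC addrA addrAC.
Qed.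

Definition quad_re x : rat := (xchoose (quad_coords x)).1.
Local Notation qre := quad_re.
Definition quad_im x : rat := (xchoose (quad_coords x)).2.
Local Notation qim := quad_im.

Lemma quadE x : x = (qre x)%:E + (qim x)%:E * s.
Proof. exact/eqP/(xchooseP (quad_coords x)). Qed.

Lemma rat_sqr_neq_d a : a ^+ 2 != d%:~R.
Proof. by apply: contraTneq (sqr_ge0 a) => ->; rewrite ler0z -ltNge. Qed.

Lemma quad_uniq a b a' b' : a%:E + b%:E * s = a'%:E + b'%:E * s -> a = a' /\
  b = b'.
Proof.
move=> e; have e2 : (b - b')%:E * s = (a' - a)%:E.
  by rewrite !rmorphB mulrBl -[X in _ = X - _](addrK (b'%:E * s)) -e; ring.
have [bb | bb] := eqVneq b b'.
  move: e2; rewrite bb subrr rmorph0 mul0r => /esym/eqP;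
    rewrite fmorph_eq0 subr_eq0.
  by move/eqP ->.
have b0 : b - b' != 0 by rewrite subr_eq0.
case/eqP: (rat_sqr_neq_d ((a' - a) / (b - b'))).
apply: (fmorph_inj (rat_alg F)); rewrite rmorphXn fmorph_div /= -e2 -[RHS]s2.
by rewrite [_ * s]mulrC mulfK // fmorph_eq0.
Qed.

Lemma qreE a b : qre (a%:E + b%:E * s) = a.
Proof. by case: (quad_uniq (quadE (a%:E + b%:E * s))). Qed.

Lemma qimE a b : qim (a%:E + b%:E * s) = b.
Proof. by case: (quad_uniq (quadE (a%:E + b%:E * s))). Qed.

Lemma qre_rat a : qre a%:E = a.
Proof. by rewrite -[a%:E]addr0 -[X in _ + X](mul0r s) -(rmorph0 (rat_alg F))
  qreE. Qed.

Lemma qim_rat a : qim a%:E = 0.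
Proof. by rewrite -[a%:E]addr0 -[X in _ + X](mul0r s) -(rmorph0 (rat_alg F))
  qimE. Qed.

Lemma quadD x y : (qre (x + y) = qre x + qre y) * (qim (x + y) = qim x + qim y).
Proof.
have -> : x + y = (qre x + qre y)%:E + (qim x + qim y)%:E * s.
  by rewrite {1}(quadE x) {1}(quadE y) !rmorphD; ring.
by rewrite qreE qimE.
Qed.

Lemma quadM x y : (qre (x * y) = qre x * qre y + d%:~R * (qim x * qim y)) *
  (qim (x * y) = qre x * qim y + qim x * qre y).
Proof.
have -> : x * y = (qre x * qre y + d%:~R * (qim x * qim y))%:E +
  (qre x * qim y + qim x * qre y)%:E * s.
  rewrite {1}(quadE x) {1}(quadE y) !rmorphD !rmorphM /= -s2; ring.
by rewrite qreE qimE.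
Qed.

Definition quad_conjugate x : F := (qre x)%:E - (qim x)%:E * s.
Local Notation qconj := quad_conjugate.

Lemma quad_conj x : (qre (qconj x) = qre x) * (qim (qconj x) = - qim x).
Proof. by rewrite /quad_conjugate -mulNr -rmorphN qreE qimE. Qed.

Lemma quad_ext x y : qre x = qre y -> qim x = qim y -> x = y.
Proof. by move=> e1 e2; rewrite (quadE x) (quadE y) e1 e2. Qed.

Lemma qconjK : involutive qconj.
Proof. by move=> x; apply: quad_ext; rewrite !quad_conj ?opprK. Qed.

Lemma qconjD : {morph qconj : x y / x + y}.
Proof. by move=> x y; apply: quad_ext; rewrite !(quadD, quad_conj) ?opprD. Qed.

Lemma qconjM : {morph qconj : x y / x * y}.
Proof. by move=> x y; apply: quad_ext; rewrite !(quadM, quad_conj); ring. Qed.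

Lemma qconj_rat a : qconj a%:E = a%:E.
Proof. by rewrite /quad_conjugate qre_rat qim_rat rmorph0 mul0r subr0. Qed.

Lemma qconjX n : {morph qconj : x / x ^+ n}.
Proof.
move=> x; elim: n => [|n IH]; last by rewrite !exprS qconjM IH.
by rewrite !expr0 -(rmorph1 (rat_alg F)) qconj_rat.
Qed.

Definition quad_trace x : rat := 2%:R * qre x.
Local Notation qtr := quad_trace.
Definition quad_norm x : rat := qre x ^+ 2 - d%:~R * qim x ^+ 2.
Local Notation qnm := quad_norm.

Lemma qtrE x : x + qconj x = (qtr x)%:E.
Proof. by apply: quad_ext; rewrite !(quadD, quad_conj, qre_rat, qim_rat) ?subrr
  // /quad_trace; ring. Qed.

Lemma qnmE x : x * qconj x = (qnm x)%:E.
Proof. by apply: quad_ext; rewrite !(quadM, quad_conj, qre_rat, qim_rat)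
  /quad_norm; ring. Qed.

Lemma qnmM x y : qnm (x * y) = qnm x * qnm y.
Proof. by rewrite /quad_norm !quadM; ring. Qed.

Lemma qnm_rat a : qnm a%:E = a ^+ 2.
Proof. by rewrite /quad_norm qre_rat qim_rat expr0n mulr0 subr0. Qed.

Lemma qnm_conj x : qnm (qconj x) = qnm x.
Proof. by rewrite /quad_norm !quad_conj sqrrN. Qed.

Let d_neg_rat : (d%:~R : rat) < 0. Proof. by rewrite ltrz0. Qed.

Lemma qnm_ge0 x : 0 <= qnm x.
Proof. by rewrite addr_ge0 ?sqr_ge0 // -mulNr mulr_ge0 ?sqr_ge0 // oppr_ge0
  ltW. Qed.

Lemma qnm_eq0 x : (qnm x == 0) = (x == 0).
Proof.
apply/eqP/eqP => [x0 | ->]; last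
  by rewrite -(rmorph0 (rat_alg F)) qnm_rat expr0n.
have [// | xn] := eqVneq x 0.
have := qnmE x; rewrite x0 rmorph0 => /eqP; rewrite mulf_eq0 (negbTE xn) /=.
by move/eqP/(congr1 qconj); rewrite qconjK -(rmorph0 (rat_alg F)) qconj_rat.
Qed.

Lemma quad_charpoly x : x ^+ 2 - (qtr x)%:E * x + (qnm x)%:E = 0.
Proof. by rewrite -qtrE -qnmE; ring. Qed.

Lemma quad_rat_integers a : @integers F a%:E -> a \is a Num.int.
Proof. by move=> /(@integers_in_alg _ F a)/rat_integers. Qed.

Lemma quad_int_integers a : a \is a Num.int -> @integers F a%:E.
Proof. by case/intrP => n ->; rewrite rmorph_int; apply: integers_int. Qed.

Lemma qconj_integers x : integers x -> integers (qconj x).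
Proof.
case=> P P_mon Px; exists P => //; move: Px; rewrite /root => /eqP Px.
suff <- : qconj (map_poly intr P).[x] = (map_poly intr P).[qconj x].
  by rewrite Px -(rmorph0 (rat_alg F)) qconj_rat.
rewrite !horner_coef.
have qsum (n : nat) (f : 'I_n -> F) : qconj (\sum_(i < n) f i) =
  \sum_(i < n) qconj (f i).
  elim/big_rec2: _ => [|i y1 y2 _ <-]; last by rewrite qconjD.
  by rewrite -(rmorph0 (rat_alg F)) qconj_rat.
rewrite qsum; apply: eq_bigr => i _; rewrite qconjM qconjX coef_map /=.
by rewrite -(rmorph_int (rat_alg F)) qconj_rat.
Qed.

Lemma integersP x : integers x <-> qtr x \is a Num.int /\ qnm x \is a Num.int.
Proof.
split=> [Ix | [It In]]; last first.
  by apply: integers_root2 (quad_charpoly x); apply: quad_int_integers.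
have Ic := qconj_integers Ix.
split; apply: quad_rat_integers; first by rewrite -qtrE; apply: integersD.
by rewrite -qnmE; apply: integersM.
Qed.

(* Norm and trace reduce this to the same statement for rational numbers. *)
Lemma almost_integral c x : c != 0 -> (forall n, integers (c * x ^+ n)) ->
  integers x.
Proof.
move=> c0 h; apply/integersP.
have nc0 : qnm c != 0 by rewrite qnm_eq0.
have qnmX n : qnm (x ^+ n) = qnm x ^+ n.
  elim: n => [|n IH]; last by rewrite !exprS qnmM IH.
  by rewrite !expr0 -(rmorph1 (rat_alg F)) qnm_rat expr1n.
split; last first.
  by apply: (rat_almost_integral nc0) => n; rewrite -qnmX -qnmM;
    case/integersP: (h n).
(* Each term of the binomial expansion of (x + qconj x)^n contains a power of x and a power of its
   conjugate; one factor [qnm c] makes each of them integral, hence the square. *)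
have m0 : qnm c ^+ 2 != 0 by rewrite sqrf_eq0.
apply: (rat_almost_integral m0) => n; apply: quad_rat_integers.
have Ic : integers c by have := h 0%N; rewrite expr0 mulr1.
have h1 k : integers ((qnm c)%:E * x ^+ k).
  by rewrite -qnmE [c * _]mulrC -mulrA; apply: integersM => //;
    apply: qconj_integers.
have h2 k : integers ((qnm c)%:E * qconj x ^+ k).
  by have := qconj_integers (h1 k); rewrite qconjM qconj_rat qconjX.
rewrite rmorphM !rmorphXn /= -qtrE exprDn mulr_sumr; apply: integers_sum => i _.
have -> : (qnm c)%:E ^+ 2 * (x ^+ (n - i) * qconj x ^+ i *+ 'C(n, i)) =
   'C(n, i)%:R * ((qnm c)%:E * x ^+ (n - i) * ((qnm c)%:E * qconj x ^+ i)).
  by rewrite -mulr_natl; ring.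
by apply: integersM; [apply: integers_nat | apply: integersM].
Qed.

Lemma integers_denominator x : exists2 m : nat, (0 < m)%N & integers (m%:R * x).
Proof.
pose m := (`|denq (qtr x)| * `|denq (qnm x)|)%N; exists m.
  by rewrite muln_gt0 !absz_gt0 !denq_neq0.
have dq a : (`|denq a|%N)%:R * a = (numq a)%:~R.
  by rewrite numqE mulrC pmulrn absz_denq.
have -> : m%:R = (m%:R)%:E by rewrite rmorph_nat.
apply/integersP; rewrite qnmM qnm_rat /quad_trace quadM qre_rat qim_rat mul0r
  mulr0 addr0.
split.
  by rewrite mulrCA -/(qtr x) natrM mulrAC dq rpredM ?intr_int // natr_int.
rewrite natrM; set u := _%:R; set v := _%:R.
have -> : (u * v) ^+ 2 * qnm x = u ^+ 2 * v * (v * qnm x) by ring.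
by rewrite dq !rpredM ?rpredX ?intr_int ?natr_int.
Qed.

End QuadraticField.

(** * Odd class numbers *)

Section OddInvolution.
(** Without a fixed point, [f] exchanges the set of i with i < f i and its complement. *)
Lemma odd_involution_ord n (f : 'I_n -> 'I_n) :
  involutive f -> odd n -> exists i, f i = i.
Proof.
move=> fK; apply: contraPP => nofix.
have fN i : f i != i by apply/eqP => fi; apply: nofix; exists i.
pose A : {set 'I_n} := [set i : 'I_n | i < f i]%SET; have cA : #|~: A| = #|A|.
  rewrite -(card_imset _ (can_inj fK)); apply: eq_card => i.
  rewrite -[in RHS](fK i) !inE; apply/imsetP/idP => [[j + ->]|];
    rewrite ?inE ?fK.
    by rewrite -leqNgt leq_eqVlt val_eqE (negbTE (fN j)).
  by move=> lt; exists (f i); rewrite ?inE ?fK // -leqNgt ltnW.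
by have := cardsC A; rewrite cA card_ord addnn => <-; rewrite odd_double.
Qed.

Local Open Scope classical_set_scope.
Local Open Scope card_scope.

Lemma odd_involution (T : Type) (A : set T) (n : nat) (g : T -> T) :
  A #= `I_n -> odd n -> (forall x, A x -> A (g x) /\ g (g x) = x) ->
  exists2 x, A x & g x = x.
Proof.
move=> /card_set_bijP[f [f_fun f_inj f_surj]] n_odd gP.
have ex (i : 'I_n) : exists x, A x /\ f x = i.
  by have [x Ax fx] := f_surj i (ltn_ord i); exists x.
have [e eP] := choice ex.
have lt (i : 'I_n) : f (g (e i)) < n.
  by apply: f_fun; case: (gP (e i)) => //; case: (eP i).
have eK x (Ax : A x) (fx : f x < n) : e (Ordinal fx) = x.
  by case: (eP (Ordinal fx)) => A' fe; apply: f_inj => //; rewrite inE.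
have [|i] := @odd_involution_ord n (fun i => Ordinal (lt i)) _ n_odd.
  move=> i; apply/val_inj; rewrite /= eK; last by case: (gP (e i)) => //;
    case: (eP i).
  by case: (eP i) => Ai <-; case: (gP _ Ai) => _ ->.
move=> /(congr1 val)/= fi; exists (e i); case: (eP i) => Ai fe //.
by case: (gP _ Ai) => Ag _; apply: f_inj; rewrite ?inE // fi fe.
Qed.
End OddInvolution.

Section Submodules.
Variable K : fieldType.
Local Open Scope ring_scope.
Local Open Scope classical_set_scope.
Implicit Types (x y : K) (I J M : set K).

Lemma submodule_genP (A : set K) : is_submodule (submodule_gen A).
Proof.
split=> [M [[]] // | x y xA yA M [M_sub AM] | a x Ia xA M [M_sub AM]].
  by case: (M_sub) => _ MD _; apply: MD; [apply: xA | apply: yA].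
by case: (M_sub) => _ _ MM; apply: MM => //; apply: xA.
Qed.

Lemma submodule_gen_sub (A M : set K) :
  is_submodule M -> A `<=` M -> submodule_gen A `<=` M.
Proof. by move=> M_sub AM x; apply; split. Qed.

Lemma sub_submodule_gen (A : set K) : A `<=` submodule_gen A.
Proof. by move=> x Ax M [_]; apply. Qed.

Lemma submodule_ideal_mul I J : is_submodule (ideal_mul I J).
Proof. exact: submodule_genP. Qed.

Lemma mem_ideal_mul I J x y : I x -> J y -> ideal_mul I J (x * y).
Proof. by move=> Ix Jy; apply: sub_submodule_gen; exists x, y. Qed.

Lemma ideal_mul_sub I J M :
  is_submodule M -> (forall x y, I x -> J y -> M (x * y)) ->
    ideal_mul I J `<=` M.
Proof. by move=> M_sub IJM; apply: submodule_gen_sub =>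
  // _ [x [y [Ix Jy ->]]]; apply: IJM. Qed.

Lemma submodule_scaled I x : is_submodule I ->
  is_submodule [set x * y | y in I].
Proof.
move=> [I0 ID IM]; split; first by exists 0; rewrite ?mulr0.
  by move=> _ _ [y Iy <-] [z Iz <-]; exists (y + z);
    [apply: ID | rewrite mulrDr].
by move=> a _ Ia [y Iy <-]; exists (a * y); [apply: IM | rewrite mulrCA].
Qed.

Lemma submodule_quotient I x : is_submodule I ->
  is_submodule [set y | I (x * y)].
Proof.
move=> [I0 ID IM]; split; rewrite /= ?mulr0 //.
  by move=> y z; rewrite mulrDr; apply: ID.
by move=> a y Ia; rewrite mulrCA; apply: IM.
Qed.

Lemma ideal_mul_scaled I J x :
  ideal_mul I [set x * y | y in J] = [set x * y | y in ideal_mul I J].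
Proof.
apply/seteqP; split.
  apply: ideal_mul_sub; first exact/submodule_scaled/submodule_ideal_mul.
  move=> y _ Iy [z Jz <-]; exists (y * z); last by rewrite mulrCA.
  exact: mem_ideal_mul.
move=> _ [y + <-].
apply: (ideal_mul_sub (M := [set y | ideal_mul I [set x * y | y in J]
  (x * y)])).
  exact/submodule_quotient/submodule_ideal_mul.
move=> z t Iz Jt /=; rewrite mulrCA; apply: mem_ideal_mul => //; by exists t.
Qed.

Lemma ideal_class_refl I : ideal_class I I.
Proof.
exists 1; rewrite ?oner_neq0 //; apply/seteqP; split => [x Ix|_ [x Ix <-]].
  by exists x; rewrite ?mul1r.
by rewrite mul1r.
Qed.

Lemma scaled_scaled I x y : [set x * z | z in [set y * z | z in I]] =
  [set x * y * z | z in I].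
Proof.
apply/seteqP; split => [_ [_ [z Iz <-] <-] | _ [z Iz <-]]; last first.
  by exists (y * z); rewrite ?mulrA //; exists z.
by exists z; rewrite ?mulrA.
Qed.

Lemma ideal_class_eq I J : ideal_class I J -> ideal_class J = ideal_class I.
Proof.
case=> x x0 ->; apply/seteqP; split => _ [y y0 ->].
  by exists (y * x); rewrite ?mulf_neq0 // scaled_scaled.
by exists (y / x); rewrite ?mulf_neq0 ?invr_eq0 // scaled_scaled divfK.
Qed.

End Submodules.

Section OddClassNumber.
Variable K : fieldType.
Local Open Scope ring_scope.
Local Open Scope classical_set_scope.
Hypothesis almost_int : forall c x : K,
  c != 0 -> (forall n, integers (c * x ^+ n)) -> integers x.
Hypothesis denominator : forall x : K, exists m : K,
  [/\ m != 0, integers m & integers (m * x)].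
Variables (a : set K) (u : K) (h : nat).
Hypotheses (h_odd : odd h) (h_class : has_class_number K h).
Hypotheses (u_neq0 : u != 0) (a_int : forall x y, a x -> a y ->
  integers (x * y / u)).
Hypothesis a_full : ideal_mul a a u.

Lemma ideal_mul_twice (J : set K) : is_submodule J ->
  ideal_mul a (ideal_mul a J) = [set u * y | y in J].
Proof.
move=> J_sub; apply/seteqP; split.
  apply: ideal_mul_sub (submodule_scaled _ J_sub) _ => x y ax.
  apply: (ideal_mul_sub (M := [set y | [set u * y | y in J] (x * y)])).
    exact/submodule_quotient/submodule_scaled.
  move=> z t az Jt /=; exists (x * z / u * t); last by field.
  by case: J_sub => _ _; apply=> //; apply: a_int.
move=> _ [t Jt <-]; rewrite mulrC; move: a_full.
apply: (ideal_mul_sub (M := [set y | ideal_mul a (ideal_mul a J) (t * y)])).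
  exact/submodule_quotient/submodule_ideal_mul.
by move=> x y ax ay /=; rewrite mulrC -mulrA; do 2!apply: mem_ideal_mul => //.
Qed.

Lemma exists_neq0 : exists2 x, a x & x != 0.
Proof.
apply: contrapT => no; case/eqP: u_neq0.
have : [set 0] u; last by [].
apply: (ideal_mul_sub _ _ a_full).
  by split=> // [x y /= -> ->|y x _ /= ->]; rewrite ?addr0 ?mulr0.
move=> x y ax ay /=; have [->|x0] := eqVneq x 0; rewrite ?mul0r //.
by case: no; exists x.
Qed.

Lemma fractional_ideal_mul (J : set K) :
  is_fractional_ideal J -> is_fractional_ideal (ideal_mul a J).
Proof.
case=> J_sub J0 [c [Ic c0] cJ]; split; first exact: submodule_ideal_mul.
  move=> aJ0; have := ideal_mul_twice J_sub; rewrite aJ0 => e; apply: J0.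
  apply/seteqP; split=> [y Jy /= | _ ->]; last by case: J_sub.
  have : [set 0] (u * y); last by move=> /= /eqP;
    rewrite mulf_eq0 (negbTE u_neq0) => /eqP.
  have : [set u * y | y in J] (u * y) by exists y.
  rewrite -e; apply: ideal_mul_sub;
    first by split=> // [? ? /= -> ->|? ? _ /= ->]; rewrite ?addr0 ?mulr0.
  by move=> x z _ /= ->; rewrite mulr0.
(* The factor x0 / u carries [a] into the integers, and [m] makes this factor itself integral. *)
have [x0 ax0 x0n] := exists_neq0; have [m [m0 Im Imx]] := denominator (x0 / u).
exists (m * (x0 / u) * c).
  split; first exact: integersM.
  by rewrite !mulf_neq0 ?invr_eq0.
apply: (ideal_mul_sub (M := [set y | integers (m * (x0 / u) * c * y)])).
  exact: submodule_quotient (submodule_integers K).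
move=> x y ax Jy /=.
have -> : m * (x0 / u) * c * (x * y) = m * (x0 * x / u) * (c * y) by field.
by apply: integersM; [apply: integersM => //; apply: a_int | apply: cJ].
Qed.

(* [a] squares to the principal ideal of [u], so multiplication by [a] is an
   involution of the class group; a fixed class [J] gives [a J = g J], hence
   [u J = g^2 J]. *)
Theorem odd_class_number_principal : exists v g : K,
  [/\ g != 0, integers v, integers v^-1 & u = v * g ^+ 2].
Proof.
pose T (C : set (set K)) := [set ideal_mul a J | J in C].
have TE J : T (ideal_class J) = ideal_class (ideal_mul a J).
  apply/seteqP; split => [_ [_ [x x0 ->] <-] | _ [x x0 ->]].
    by exists x; rewrite ?ideal_mul_scaled.
  by exists [set x * y | y in J]; rewrite ?ideal_mul_scaled //; exists x.
have [_ [J J_frac <-]] : exists2 C, class_group C & T C = C.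
  apply: odd_involution h_class h_odd _ => _ [J J_frac <-]; rewrite !TE; split.
    by exists (ideal_mul a J) => //; apply: fractional_ideal_mul.
  apply: ideal_class_eq; exists u => //; apply: ideal_mul_twice;
    by case: J_frac.
rewrite TE => eJ; have : ideal_class J (ideal_mul a J) by rewrite -eJ;
  apply: ideal_class_refl.
case=> g g0 aJ; have [J_sub Jn0 [c [Ic c0] cJ]] := J_frac.
have e : [set u * y | y in J] = [set g ^+ 2 * y | y in J].
  by rewrite -ideal_mul_twice // aJ ideal_mul_scaled aJ scaled_scaled expr2.
have [j Jj j0] : exists2 j, J j & j != 0.
  apply: contrapT => no; apply: Jn0; apply/seteqP; split=> [y Jy /= | _ ->];
    last by case: J_sub.
  by have [//|y0] := eqVneq y 0; case: no; exists y.
(* If x stabilizes J, then j x^n stays in J for all n, so c clears all these denominators at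
   once. *)
have stab x : (forall y, J y -> J (x * y)) -> integers x.
  move=> xJ; apply: (@almost_int (c * j)); first by rewrite mulf_neq0.
  move=> n; rewrite -mulrA; apply: cJ; rewrite mulrC.
  by elim: n => [|n IH]; rewrite ?expr0 ?mul1r // exprS -mulrA; apply: xJ.
have g20 : g ^+ 2 != 0 by rewrite sqrf_eq0.
exists (u / g ^+ 2), g; split => //; last by rewrite divfK.
  apply: stab => y Jy; have : [set u * y | y in J] (u * y) by exists y.
  by rewrite e => -[z Jz gz]; rewrite mulrAC -gz mulrC mulKf.
apply: stab => y Jy; have : [set g ^+ 2 * y | y in J] (g ^+ 2 * y) by exists y.
by rewrite -e => -[z Jz gz]; rewrite invf_div mulrAC -gz mulrC mulKf.
Qed.

End OddClassNumber.

Section SqrtIdeal.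
Variable K : fieldType.
Local Open Scope ring_scope.
Local Open Scope classical_set_scope.
Implicit Types (x y u : K).

(* The ideal [sqrt(u) O_M] of [M = K(sqrt u)], cut down to [K]. *)
Definition sqrt_ideal u : set K := [set x | integers (x ^+ 2 / u)].

Lemma sqrt_ideal_mul u x y : u != 0 ->
  sqrt_ideal u x -> sqrt_ideal u y -> integers (x * y / u).
Proof.
move=> u0 Ix Iy; apply: integers_sqrt.
have -> : (x * y / u) ^+ 2 = x ^+ 2 / u * (y ^+ 2 / u) by field.
exact: integersM.
Qed.

Lemma submodule_sqrt_ideal u : u != 0 -> is_submodule (sqrt_ideal u).
Proof.
move=> u0; split; rewrite /sqrt_ideal /=.
- by rewrite expr0n mul0r; apply: integers0.
- move=> x y Ix Iy; have -> : (x + y) ^+ 2 / u = x ^+ 2 / u + y ^+ 2 / u +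
  2%:R * (x * y / u) by field.
  apply: integersD; first exact: integersD.
  by apply: integersM; [apply: integers_nat | apply: sqrt_ideal_mul].
move=> c x Ic Ix; rewrite exprMn -mulrA; apply: integersM => //;
  exact: integersX.
Qed.
End SqrtIdeal.

Section SquarefreeInt.
Local Open Scope ring_scope.

(** The square of the denominator of b divides n. *)
Lemma squarefree_mul_sqr_int (n : int) (b : rat) :
  n != 0 -> squarefreez n -> n%:~R * b ^+ 2 \is a Num.int -> b \is a Num.int.
Proof.
move=> n0 n_sqf /intrP[k nk]; rewrite Qint_def.
have e : n * numq b ^+ 2 = k * denq b ^+ 2.
  by apply: (@intr_inj rat); rewrite [LHS]intrM [RHS]intrM !rmorphXn /= numqE
    exprMn -nk; ring.
have dn : (`|denq b| ^ 2 %| `|n|)%N.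
  rewrite -(@Gauss_dvdl _ _ (`|numq b| ^ 2)); last first.
    by rewrite coprime_sym coprimeXl // coprimeXr // coprime_num_den.
  by rewrite -!abszX -abszM e abszM dvdn_mull.
have := n_sqf _ dn; have := denq_gt0 b; move: (denq b) => D; lia.
Qed.

Lemma squarefreez1 : squarefreez 1.
Proof. by move=> n; rewrite dvdn1 => /eqP; case: n => [|[|n]]. Qed.

Lemma rat_sqr_int (b : rat) : b ^+ 2 \is a Num.int -> b \is a Num.int.
Proof.
move=> h; apply: (@squarefree_mul_sqr_int 1) => //; first exact: squarefreez1.
by rewrite mul1r.
Qed.

Lemma prime_not_rat_sqr (r : nat) (b : rat) : prime r -> b ^+ 2 != r%:R.
Proof.
move=> r_pr; apply/eqP => e; have : b \is a Num.int.
  by apply: rat_sqr_int; rewrite e natr_int.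
case/intrP => k bk; have : (`|k| ^ 2)%N = r.
  apply/eqP; rewrite -eqz_nat -abszX gez0_abs ?sqr_ge0 //.
  by rewrite -(eqr_int rat) rmorphXn /= -bk e pmulrn.
move=> kr; have := r_pr; rewrite -kr expnS expn1; case: (`|k|%N) => [|[|m]] //.
by apply/negP/primePn; right; exists m.+2; rewrite ?dvdn_mulr //; lia.
Qed.
End SquarefreeInt.

(** * Units and ramified primes when the class number is odd *)

Section QuadraticClassNumber.
Variables (F : fieldExtType rat) (s : F) (d : int).
Local Open Scope ring_scope.
Local Open Scope classical_set_scope.
Hypotheses (s_sqrt : s ^+ 2 = d%:~R) (F_gen : <<1;
  s>>%VS = {:F}%VS) (d_neg : d < 0).
Hypothesis d_sqf : squarefreez d.
Implicit Types (x y : F) (a b : rat).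

Local Notation "a %:E" := (rat_alg F a) : ring_scope.
Local Notation qre := (quad_re s_sqrt F_gen).
Local Notation qim := (quad_im s_sqrt F_gen).
Local Notation qnm := (quad_norm s_sqrt F_gen).
Local Notation integersP := (integersP s_sqrt F_gen d_neg).

Let natE (n : nat) : n%:R = (n%:R)%:E. Proof. by rewrite rmorph_nat. Qed.
Let d_rat : (d%:~R : rat) < 0. Proof. by rewrite ltrz0. Qed.
Let d0 : d != 0. Proof. by rewrite lt_eqF. Qed.

Lemma natF_neq0 n : (n.+1%:R : F) != 0.
Proof. by rewrite natE fmorph_eq0 pnatr_eq0. Qed.

(** A unit has norm 1 and an integer trace T with T^2 <= 4, so that (1 + x)^2 = x (2 + T). This
    settles each T: x = -1 for T = -2, x^2 = -1 for T = 0, and otherwise x is (1 + x)^2 / (2 + T),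
    where for T = 1 the denominator 3 is minus the square of 2x - 1. *)
Lemma quad_unit x : integers x -> integers x^-1 -> x != 0 ->
  [\/ exists t, x = t ^+ 2, exists t, x = - t ^+ 2 | exists t : F, t ^+ 2 = -1].
Proof.
move=> /integersP[/intrP[T xT] xn] /integersP[_ xn'] x0.
have nx : qnm x = 1.
  have e : qnm x * qnm x^-1 = 1.
    rewrite -(qnmM s_sqrt F_gen d_neg) divff // -(rmorph1 (rat_alg F)).
    by rewrite (qnm_rat s_sqrt F_gen d_neg) expr1n.
  move: xn xn' e (qnm_ge0 s_sqrt F_gen d_neg x)
    (qnm_ge0 s_sqrt F_gen d_neg x^-1).
  move=> /intrP[m ->] /intrP[n ->]; rewrite -intrM !ler0z -[1]/(1%:~R) =>
    /intr_inj mn m0 n0.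
  by congr _%:~R; case: m n m0 n0 mn => [m|//] [n|//] _ _ [/eqP];
    rewrite muln_eq1 => /andP[/eqP-> _].
have tE : 2%:R * qre x = T%:~R by rewrite -xT.
have T4 : T ^+ 2 <= 4.
  rewrite -(ler_int rat) rmorphXn /= -tE; have := sqr_ge0 (qim x).
  by move: nx d_rat; rewrite /qnm => *; nra.
have key : (1 + x) ^+ 2 = x * (2%:R + T%:~R).
  have := qtrE s_sqrt F_gen d_neg x; rewrite xT rmorph_int => <-.
  have := qnmE s_sqrt F_gen d_neg x; rewrite nx rmorph1 => h.
  by ring: h.
have chp := quad_charpoly s_sqrt F_gen d_neg x;
  rewrite nx xT rmorph_int rmorph1 in chp.
have Tcases : [\/ T = -2, T = -1, T = 0 | T = 1 \/ T = 2].
  have h1 : -3 < T by nia.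
  have h2 : T < 3 by nia.
  have : T = -2 \/ T = -1 \/ T = 0 \/ T = 1 \/ T = 2 by lia.
  by case=> [|[|[|[]]]] ->; [constructor 1|constructor 2|constructor
    3|constructor 4; left|constructor 4; right].
case: Tcases => [e|e|e|[e|e]]; move: key chp; rewrite e => key chp.
- constructor 2; exists 1; rewrite expr1n; apply/eqP;
  rewrite -addr_eq0 addrC -sqrf_eq0 key.
  by rewrite -[2%:R]/(2%:~R) -intrD mulr0z mulr0.
- by constructor 1; exists (1 + x); rewrite key -[2%:R]/(2%:~R) -intrD mulr1.
- constructor 3; exists x; apply/eqP; rewrite -subr_eq0 opprK.
  by move/eqP: chp; rewrite mul0r subr0.
- have n3 : (3%:R : F) != 0 := natF_neq0 2.
  have sq3 : (2%:R * x - 1) ^+ 2 = - 3%:R.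
    have -> : (2%:R * x - 1) ^+ 2 = 4%:R * (x ^+ 2 - 1%:~R * x + 1) - 3%:R
      by ring.
    by rewrite chp mulr0 sub0r.
  have w0 : 2%:R * x - 1 != 0 by rewrite -sqrf_eq0 sq3 oppr_eq0.
  constructor 2; exists ((1 + x) / (2%:R * x - 1)).
  rewrite expr_div_n sq3 key -[2%:R]/(2%:~R) -intrD -[(2 + 1)%:~R]/(3%:R) invrN
    mulrN opprK.
  by rewrite mulfK.
- have n2 : (2%:R : F) != 0 := natF_neq0 1.
  constructor 1; exists ((1 + x) / 2%:R); rewrite expr_div_n key.
  rewrite -[X in _ * (X + _)]/(2%:~R) -intrD -[(2 + 2)%:~R]/(4%:R);
    field. exact: natF_neq0 3.
Qed.

(** The coefficient of s in t^2 vanishes, so t is rational or a rational multiple of s. *)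
Lemma rat_square_in_quad a : (exists t : F, a%:E = t ^+ 2) ->
  exists b, a = b ^+ 2 \/ a = d%:~R * b ^+ 2.
Proof.
case=> t at2; have e1 := congr1 qre at2; have e2 := congr1 qim at2.
move: e1 e2; rewrite (qre_rat s_sqrt F_gen d_neg) (qim_rat s_sqrt F_gen d_neg)
  expr2.
rewrite !(quadM s_sqrt F_gen d_neg) => e1 e2.
have : qre t * qim t = 0 by lra.
move/eqP; rewrite mulf_eq0 => /orP[] /eqP e; rewrite e in e1.
  by exists (qim t); right; rewrite e1; ring.
by exists (qre t); left; rewrite e1; ring.
Qed.

Lemma sqrtN1_in_quad : (exists t : F, t ^+ 2 = -1) -> d = -1.
Proof.
case=> t t2; have [|b [e|e]] := @rat_square_in_quad (-1).
- by exists t; rewrite t2 rmorphN rmorph1.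
- by have := sqr_ge0 b; rewrite -e oppr_ge0 ler10.
have : b \is a Num.int.
  by apply: (squarefree_mul_sqr_int d0 d_sqf); rewrite -e;
    apply: (intr_int _ (-1)).
case/intrP => k bk; move: e; rewrite bk -rmorphXn -intrM -[-1]/((-1)%:~R) =>
  /intr_inj /(congr1 absz)/esym/eqP.
by rewrite abszM muln_eq1 => /andP[/eqP d1 _]; lia.
Qed.

(** [e] is the sign. As r and -r are not rational squares, the prime is up to sign d b^2, with b an
    integer because d is squarefree. *)
Lemma prime_square_in_quad (r : nat) (e : bool) : prime r ->
  (exists t : F, ((-1) ^+ e * r%:Z)%:~R = t ^+ 2) -> (d %| r%:Z)%Z.
Proof.
move=> r_pr [t rt]; have r0 : 0 < (r%:R : rat) by rewrite ltr0n prime_gt0.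
have [|b [h|h]] := @rat_square_in_quad ((-1) ^+ e * r%:Z)%:~R.
- by exists t; rewrite rmorph_int.
- case: e {rt} h; rewrite ?expr1 ?expr0 ?mul1r => h.
    by have := sqr_ge0 b; rewrite -h mulN1r intrN oppr_ge0 -[_%:~R]/(r%:R)
      leNgt r0.
  by case/eqP: (prime_not_rat_sqr b r_pr); rewrite -h.
have : b \is a Num.int by apply: (squarefree_mul_sqr_int d0 d_sqf);
  rewrite -h intr_int.
case/intrP => k bk; move: h; rewrite bk -rmorphXn -intrM => /intr_inj h.
have : (d %| (-1) ^+ e * r%:Z)%Z by rewrite h dvdz_mulr.
by case: e {rt h}; rewrite ?expr1 ?expr0 ?mul1r // mulN1r rpredN.
Qed.

Variable h : nat.
Hypotheses (h_odd : odd h) (h_class : has_class_number F h).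

Lemma class_square (u : F) : u != 0 ->
  ideal_mul (sqrt_ideal u) (sqrt_ideal u) u ->
  [\/ exists t, u = t ^+ 2, exists t, u = - t ^+ 2 | exists t : F, t ^+ 2 = -1].
Proof.
move=> u0 u_full.
have denom x : exists m : F, [/\ m != 0, integers m & integers (m * x)].
  have [[|m] // _ Im] := integers_denominator s_sqrt F_gen d_neg x.
  by exists m.+1%:R; split=> //; [apply: natF_neq0 | apply: integers_nat].
have [v [g [g0 Iv Iv' uE]]] := odd_class_number_principal
  (almost_integral s_sqrt F_gen d_neg) denom h_odd h_class u0
  (fun x y => sqrt_ideal_mul u0) u_full.
have v0 : v != 0 by apply: contraNneq u0 => v0; rewrite uE v0 mul0r.
have [[t vt]|[t vt]|t2] := quad_unit Iv Iv' v0; last by constructor 3.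
  by constructor 1; exists (t * g); rewrite uE vt exprMn.
by constructor 2; exists (t * g); rewrite uE vt exprMn mulNr.
Qed.

Lemma s_integer : integers s.
Proof. by apply: integers_sqrt; rewrite s_sqrt; apply: integers_int. Qed.

Lemma prime_square_cases (r : nat) : prime r ->
  ideal_mul (sqrt_ideal (r%:R : F)) (sqrt_ideal r%:R) r%:R ->
    (d %| r%:Z)%Z \/ d = -1.
Proof.
move=> r_pr r_full; have r0 : (r%:R : F) != 0.
  by case: r r_pr {r_full} => // r _; apply: natF_neq0.
have [[t rt]|[t rt]|/sqrtN1_in_quad] := class_square r0 r_full; last by right.
  by left; apply: (@prime_square_in_quad r false) => //; exists t;
    rewrite mul1r -rt.
left; apply: (@prime_square_in_quad r true) => //; exists t.
by rewrite mulN1r intrN -pmulrn rt opprK.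
Qed.

(** A prime factor r of d ramifies: the ideal (r, s) has square (r), since d / r and r are coprime.
    So d divides r, unless d = -1. *)
Lemma prime_dvd_disc (r : nat) : prime r -> (r %| d)%Z -> d = - r%:Z.
Proof.
move=> r_pr /dvdzP[m dm].
have r0 : (r%:R : F) != 0 by case: r r_pr {dm} => // r _; apply: natF_neq0.
have co : coprimez m r.
  rewrite coprimezE coprime_sym prime_coprime //; apply/negP => rm.
  have : (r ^ 2 %| `|d|)%N by rewrite dm abszM expnS expn1 dvdn_mul.
  by move/d_sqf => r1; rewrite r1 in r_pr.
have [a [b ab]] := Bezoutz m r; rewrite (eqP co) in ab.
have r_full : ideal_mul (sqrt_ideal (r%:R : F)) (sqrt_ideal r%:R) r%:R.
  have Ir : sqrt_ideal r%:R (r%:R : F)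
    by rewrite /sqrt_ideal /= expr2 mulfK //; apply: integers_nat.
  have Is : sqrt_ideal r%:R s.
    rewrite /sqrt_ideal /= s_sqrt dm intrM -pmulrn mulfK //;
      exact: integers_int.
  have [_ ID IM] := submodule_ideal_mul (sqrt_ideal (r%:R : F))
    (sqrt_ideal r%:R).
  have rE : (r%:R : F) = a%:~R * (s * s) + b%:~R * (r%:R * r%:R).
    have := congr1 (intr : int -> F) ab;
      rewrite intrD [in LHS]intrM [X in _ + X = _]intrM => e.
    transitivity ((a%:~R * m%:~R + b%:~R * r%:R) * r%:R : F);
      first by rewrite e mul1r.
    by rewrite -expr2 s_sqrt dm intrM; ring.
  by rewrite [X in ideal_mul _ _ X]rE; apply: ID;
    (apply: IM; [apply: integers_int | apply: mem_ideal_mul]).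
have r1 := prime_gt1 r_pr.
case: (prime_square_cases r_pr r_full) => [|d1]; last first.
  by move: dm; rewrite d1 => /esym e; have : (r %| 1)%N
    by [rewrite -(dvdzE r 1) ; apply/dvdzP; exists (- m); lia]; rewrite dvdn1;
      lia.
rewrite dvdzE absz_nat dm => /(dvdn_leq (prime_gt0 r_pr));
  rewrite abszM absz_nat.
move: d_neg; rewrite dm; move: m {dm co ab} => m *; nia.
Qed.

(** In this case 2 ramifies: with d = 4k + 3 one has 2 = -(1 + s)(1 - s) - 4k, a combination of
    products of elements of [sqrt_ideal 2]. *)
Lemma disc_mod4_neq3 : (d = 3 %[mod 4])%Z -> d = -1.
Proof.
move=> d3; have n2 : (2%:R : F) != 0 := natF_neq0 1.
have [k dk] : exists k, d = 4 * k + 3.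
  by exists (d %/ 4)%Z; rewrite {1}(divz_eq d 4) d3; lia.
have two_full : ideal_mul (sqrt_ideal (2%:R : F)) (sqrt_ideal 2%:R) 2%:R.
  have I2 : sqrt_ideal 2%:R (2%:R : F)
    by rewrite /sqrt_ideal /= expr2 mulfK //; apply: integers_nat.
  have Is (e : F) : e ^+ 2 = 1 -> integers e -> sqrt_ideal 2%:R (1 + e * s).
    move=> e2 Ie; rewrite /sqrt_ideal /=.
    have -> : (1 + e * s) ^+ 2 / 2%:R = (2 * k + 2)%:~R + e * s.
      have -> : (1 + e * s) ^+ 2 = 1 + e ^+ 2 * s ^+ 2 + 2%:R * e * s by ring.
      by rewrite e2 s_sqrt dk !intrD !intrM; field.
    by apply: integersD; [apply: integers_int | apply: integersM => //;
      apply: s_integer].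
  have [_ ID IM] := submodule_ideal_mul (sqrt_ideal (2%:R : F))
    (sqrt_ideal 2%:R).
  have twoE : (2%:R : F) = (-1)%:~R * ((1 + 1 * s) * (1 + (-1) * s)) +
    (- k)%:~R * (2%:R * 2%:R).
    have -> : (1 + 1 * s) * (1 + -1 * s) = 1 - s ^+ 2 by ring.
    by rewrite s_sqrt dk !rmorphN /= !intrD !intrM; ring.
  rewrite [X in ideal_mul _ _ X]twoE.
  apply: ID; (apply: IM; [apply: integers_int | apply: mem_ideal_mul => //]).
    by apply: Is; [rewrite expr1n | apply: integers1].
  by apply: Is; [rewrite sqrrN expr1n | apply: integersN; apply: integers1].
case: (prime_square_cases (isT : prime 2) two_full) => // d2.
have : (`|d| <= 2)%N by apply: dvdn_leq => //; rewrite -(absz_nat 2) -dvdzE.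
by move: d_neg; rewrite dk; lia.
Qed.

End QuadraticClassNumber.

(** * Class number one for d >= -2, and genus theory *)

Section Euclidean.
Variables (F : fieldExtType rat) (s : F) (d : int).
Local Open Scope ring_scope.
Local Open Scope classical_set_scope.
Hypotheses (s_sqrt : s ^+ 2 = d%:~R) (F_gen : <<1;
  s>>%VS = {:F}%VS) (d_neg : d < 0).
Implicit Types (x y : F) (a b : rat).

Local Notation "a %:E" := (rat_alg F a) : ring_scope.
Local Notation qre := (quad_re s_sqrt F_gen).
Local Notation qim := (quad_im s_sqrt F_gen).
Local Notation qnm := (quad_norm s_sqrt F_gen).
Local Notation integersP := (integersP s_sqrt F_gen d_neg).

Lemma rat_nearest_int a : exists n : int, (a - n%:~R) ^+ 2 <= 4%:R^-1.
Proof.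
exists (Num.floor (a + 2%:R^-1)).
have := floor_le (a + 2%:R^-1); have := floorD1_gt (a + 2%:R^-1).
by rewrite intrD; move: (Num.floor _)%:~R => m *; nra.
Qed.

(** Rounding both coordinates leaves an error of norm at most (1 + |d|)/4 <= 3/4. *)
Lemma quad_euclidean x : -2 <= d -> exists2 z, integers z & qnm (x - z) < 1.
Proof.
move=> d2; have [m hm] := rat_nearest_int (qre x);
  have [n hn] := rat_nearest_int (qim x).
exists (m%:~R + n%:~R * s).
  by apply: integersD; [|apply: integersM]; rewrite ?integers_int //;
    try exact: integers_int; apply: s_integer s_sqrt.
have -> : x - (m%:~R + n%:~R * s) = (qre x - m%:~R)%:E + (qim x - n%:~R)%:E * s.
  by rewrite {1}(quadE s_sqrt F_gen x) !rmorphB !rmorph_int /=; ring.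
rewrite /quad_norm (qreE s_sqrt F_gen d_neg) (qimE s_sqrt F_gen d_neg).
have {}d2 : (-2)%:~R <= (d%:~R : rat) by rewrite ler_int.
have := sqr_ge0 (qim x - n%:~R); nra.
Qed.

Lemma quad_euclidean_class_group : -2 <= d ->
  class_group (K := F) `<=` [set ideal_class (@integers F)].
Proof.
move=> d2 _ [I [I_sub I0 [c [Ic c0] cI]] <-] /=.
have [I_0 ID IM] := I_sub.
have [j Ij j0] : exists2 j, I j & j != 0.
  apply: contrapT => no; apply: I0; apply/seteqP; split=> [y Iy /= | _ -> //].
  by have [//|y0] := eqVneq y 0; case: no; exists y.
(* The factor c makes the norms on I natural numbers. A nonzero element of least norm generates I,
   because the remainder of a division by it has smaller norm. *)
pose N x := `|Num.floor (qnm (c * x))|%N.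
have NE x : I x -> qnm (c * x) = (N x)%:R.
  move=> Ix; have [_ /intrP[k nk]] := (integersP (c * x)).1 (cI _ Ix).
  have := qnm_ge0 s_sqrt F_gen d_neg (c * x);
    rewrite /N nk intrKfloor ler0z => k0.
  by rewrite pmulrn gez0_abs.
have ex : exists n, `[< exists x : F, [/\ I x, x != 0 & N x = n] >].
  by exists (N j); apply/asboolP; exists j.
case: (ex_minnP ex) => n /asboolP[g [Ig g0 Ng]] n_min.
suff -> : I = [set g * y | y in @integers F].
  by apply: ideal_class_eq; exists g.
apply/seteqP; split => [y Iy | _ [y Iy <-]]; last by rewrite mulrC; apply: IM.
have [z Iz hz] := quad_euclidean (y / g) d2; exists z => //.
apply/esym/eqP; rewrite -subr_eq0; apply/negPn/negP => r0.
have Ir : I (y - g * z).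
  apply: ID => //; rewrite mulrC -mulNr; apply: IM => //; exact: integersN.
have : (n <= N (y - g * z)%R)%N by apply: n_min; apply/asboolP;
  exists (y - g * z).
rewrite leqNgt -(ltr_nat rat) -NE // -Ng -NE // => /negP[].
have -> : c * (y - g * z) = (c * g) * (y / g - z) by field.
rewrite (qnmM s_sqrt F_gen d_neg) gtr_pMr // lt_neqAle
  (qnm_ge0 s_sqrt F_gen d_neg) andbT.
by rewrite eq_sym (qnm_eq0 s_sqrt F_gen d_neg) mulf_neq0.
Qed.

Lemma class_number_gt1 (h : nat) : (1 < h)%N -> has_class_number F h -> d < -2.
Proof.
move=> h1 /card_set_bijP[f [f_fun f_inj f_surj]]; rewrite ltNge;
  apply/negP => d2.
have sub := quad_euclidean_class_group d2.
have [C0 h0 e0] := f_surj 0%N (ltnW h1); have [C1 h1' e1] := f_surj 1%N h1.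
by move: e1; rewrite (sub _ h1') -(sub _ h0) e0.
Qed.

(* Genus theory: with an odd class number at most one prime ramifies. *)
Theorem odd_class_number_disc (h : nat) : squarefreez d -> odd h -> (1 < h)%N ->
  has_class_number F h -> exists r : nat,
    [/\ prime r, (r %% 4 = 3)%N & d = - r%:Z].
Proof.
move=> d_sqf h_odd h1 h_class; have d2 := class_number_gt1 h1 h_class.
pose r := pdiv `|d|%N; have r_pr : prime r by apply: pdiv_prime; lia.
have dr : d = - r%:Z.
  apply: (prime_dvd_disc s_sqrt F_gen d_neg d_sqf h_odd h_class) => //.
  by rewrite dvdzE; apply: pdiv_dvd.
exists r; split=> //.
(* Here r = 2 would give d = -2, and below r = 1 modulo 4 would give d = 3 modulo 4. *)
have r_odd : odd r by case: (even_prime r_pr) => // r2; move: d2; rewrite dr r2.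
have : (d = 3 %[mod 4])%Z -> d = -1 by apply:
  (disc_mod4_neq3 s_sqrt F_gen d_neg d_sqf h_odd h_class).
rewrite dr => nd; apply/eqP; apply: contraT => r3.
by have := nd (ltac:(lia)); lia.
Qed.

End Euclidean.

(** * Unramified quadratic extensions *)

Section MaximalIdeals.
Variable K : fieldType.
Local Open Scope ring_scope.
Local Open Scope classical_set_scope.
Implicit Types (x y : K) (I P : set K).

Definition maximal_ideal P : Prop :=
  [/\ is_ideal P, ~ P 1
    & forall x, integers x -> ~ P x -> exists2 y, integers y & P (1 - x * y)].

Lemma exists_maximal_ideal I : is_ideal I -> ~ I 1 ->
  exists2 P, maximal_ideal P & I `<=` P.
Proof.
(* Zorn's lemma also asks for the union of the empty chain. Adding I to each X makes the empty set a
   member of the family. *)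
move=> I_id I1; pose Z X := is_ideal (I `|` X) /\ ~ (I `|` X) 1.
have [[I0 ID IM] I_int] := I_id.
have [C CZ C_tot | A [[A_id A1] A_max]] := @Zorn_bigcup K Z.
  have split x : (I `|` \bigcup_(X in C) X) x ->
    I x \/ exists2 X, C X & (I `|` X) x.
    by case=> [Ix|[X CX Xx]]; [left | right; exists X => //; right].
  have join X x : C X -> (I `|` X) x -> (I `|` \bigcup_(X in C) X) x.
    by move=> CX [Ix|Xx]; [left | right; exists X].
  split; last by move/split => [// | [X /CZ[_ X1] /X1]].
  split; last by move=> x /split[/I_int // | [X /CZ[[_ X_int] _] /X_int]].
  split; first by left.
    move=> x y /split[Ix|[X CX Xx]] /split[Iy|[Y CY Yy]].
    - by left; apply: ID.
    - by apply: (join Y) => //; have [[[_ YD _] _] _] := CZ Y CY;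
      apply: YD => //; left.
    - by apply: (join X) => //; have [[[_ XD _] _] _] := CZ X CX;
      apply: XD => //; left.
    have [XY|YX] := C_tot _ _ CX CY.
      apply: (join Y) => //; have [[[_ YD _] _] _] := CZ Y CY; apply: YD => //.
      by case: Xx => [|/XY]; [left | right].
    apply: (join X) => //; have [[[_ XD _] _] _] := CZ X CX; apply: XD => //.
    by case: Yy => [|/YX]; [left | right].
  move=> a x Ia /split[Ix|[X CX Xx]]; first by left; apply: IM.
  by apply: (join X) => //; have [[[_ _ XM] _] _] := CZ X CX; apply: XM.
exists (I `|` A) => //; split=> // x Ix nPx.
have [[P0 PD PM] P_int] := A_id.
(* [B] is P + x O, which properly contains P; by maximality it contains 1. *)
pose B : set K := [set z | exists2 p, (I `|` A) p & exists2 y,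
  integers y & z = p + x * y].
have PB z : (I `|` A) z -> B z.
  by move=> Pz; exists z => //; exists 0; rewrite ?mulr0 ?addr0 //;
    apply: integers0.
have B_id : is_ideal B.
  split; last by move=> _ [p /P_int Ip [y Iy ->]]; apply: integersD => //;
    apply: integersM.
  split; first exact: PB.
    move=> _ _ [p Pp [y Iy ->]] [q Pq [z Iz ->]]; exists (p + q);
      first exact: PD.
    by exists (y + z); [apply: integersD | ring].
  move=> a _ Ia [p Pp [y Iy ->]]; exists (a * p); first exact: PM.
  by exists (a * y); [apply: integersM | ring].
have IB : I `|` B = B by apply/seteqP; split=> [z [Iz|//]|z Bz];
  [apply: PB; left | right].
have : ~ Z B.
  apply: A_max; split; first by move=> z Az; apply: PB; right.
  move=> BA; apply: nPx; right; apply: BA; exists 0 => //; exists 1;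
    rewrite ?mulr1 ?add0r //.
  exact: integers1.
rewrite /Z IB => nB; have [p Pp [y Iy e]] : B 1.
  by apply: contrapT => B1; apply: nB.
by exists y => //; rewrite e addrK.
Qed.

Lemma maximal_ideal_prime P : maximal_ideal P -> is_prime_ideal P.
Proof.
case=> [P_id P1 P_max]; split=> // x y Ix Iy Pxy.
have [[P0 PD PM] P_int] := P_id.
have [Px | nPx] := pselect (P x); [by left | right].
have [z Iz Pz] := P_max x Ix nPx.
have -> : y = y * (1 - x * z) + z * (x * y) by ring.
by apply: PD; apply: PM.
Qed.
End MaximalIdeals.

(** * Inverting a prime ideal of the quadratic field *)

Section QuadraticPrimes.
Variables (F : fieldExtType rat) (s : F) (d : int).
Local Open Scope ring_scope.
Local Open Scope classical_set_scope.
Hypotheses (s_sqrt : s ^+ 2 = d%:~R) (F_gen : <<1;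
  s>>%VS = {:F}%VS) (d_neg : d < 0).
Implicit Types (x y : F) (a b : rat).

Local Notation "a %:E" := (rat_alg F a) : ring_scope.
Local Notation qtr := (quad_trace s_sqrt F_gen).
Local Notation qnm := (quad_norm s_sqrt F_gen).
Local Notation qconj := (quad_conjugate s_sqrt F_gen).
Local Notation integersP := (integersP s_sqrt F_gen d_neg).

Variable P : set F.
Hypothesis P_max : maximal_ideal P.

Let P_sub : is_submodule P. Proof. by case: P_max => -[]. Qed.
Let P_int x : P x -> integers x. Proof. by case: P_max => -[_ +] _ _;
  apply. Qed.
Let P_prime : is_prime_ideal P. Proof. exact: maximal_ideal_prime. Qed.
Let PD x y : P x -> P y -> P (x + y). Proof. by case: P_sub => _ + _;
  apply. Qed.
Let PM x y : integers x -> P y -> P (x * y). Proof. by case: P_sub => _ _;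
  apply. Qed.
Let P1 : ~ P 1. Proof. by case: P_max. Qed.

(** [P] contains the norm of a nonzero element, a positive integer, and by primality one of the
    prime factors of this integer. *)
Lemma prime_in_ideal : P <> [set 0] -> exists2 r : nat, prime r & P r%:R.
Proof.
move=> Pn0; have [x Px x0] : exists2 x, P x & x != 0.
  apply: contrapT => no; apply: Pn0; apply/seteqP; split=> [x Px /= | _ ->];
    last by case: P_sub.
  by have [//|x0] := eqVneq x 0; case: no; exists x.
have [_ /intrP[k nk]] := (integersP x).1 (P_int Px).
have k0 : 0 < k.
  rewrite -(ltr0z rat) -nk lt_neqAle (qnm_ge0 s_sqrt F_gen d_neg) andbT eq_sym.
  by rewrite (qnm_eq0 s_sqrt F_gen d_neg).
have Pk : P (`|k|%N)%:R.
  have -> : (`|k|%N)%:R = qconj x * x.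
    by rewrite mulrC (qnmE s_sqrt F_gen d_neg) nk rmorph_int pmulrn gtz0_abs.
  apply: PM => //; apply: (qconj_integers s_sqrt F_gen d_neg); exact: P_int.
have : (0 < `|k|)%N by lia.
move: `|k|%N Pk => n; have [m] := ubnP n; elim: m n => // m IH n ltnm Pn n0.
have [n1 | n1] := leqP n 1.
  by case: P1; move: Pn; have -> : n = 1%N by lia.
have np := pdiv_prime n1; move: Pn; rewrite -(divnK (pdiv_dvd n)) natrM.
have [_ _ /[apply]] := P_prime;
  move=> /(_ (integers_nat _ _) (integers_nat _ _)) [] Pn;
    last by exists (pdiv n).
apply: IH Pn _; last by rewrite divn_gt0 ?pdiv_gt0 // dvdn_leq ?pdiv_dvd.
by apply: leq_trans (ltn_Pdiv _ _) _; rewrite ?prime_gt1 // -ltnS.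
Qed.

Variable r : nat.
Hypotheses (r_pr : prime r) (Pr : P r%:R).

Lemma int_in_ideal (k : int) : P k%:~R -> (r %| k)%Z.
Proof.
move=> Pk; apply: contraT => rk.
have co : coprimez k r by rewrite coprimezE coprime_sym prime_coprime.
have [a [b ab]] := Bezoutz k r; rewrite (eqP co) in ab.
case: P1; have <- : a%:~R * k%:~R + b%:~R * r%:R = 1 :> F.
  by have := congr1 (intr : int -> F) ab; rewrite intrD !intrM.
by apply: PD; apply: PM => //; apply: integers_int.
Qed.

Let r0 : (r%:R : rat) != 0. Proof. by rewrite pnatr_eq0 -lt0n prime_gt0. Qed.

Lemma qnm_in_ideal x : P x -> exists k : int, qnm x = r%:R * k%:~R.
Proof.
move=> Px; have [_ /intrP[k nk]] := (integersP x).1 (P_int Px).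
have /dvdzP[m km] : (r %| k)%Z.
  apply: int_in_ideal; have <- : qconj x * x = k%:~R.
    by rewrite mulrC (qnmE s_sqrt F_gen d_neg) nk rmorph_int.
  apply: PM => //; apply: (qconj_integers s_sqrt F_gen d_neg); exact: P_int.
by exists m; rewrite nk km intrM mulrC.
Qed.

(** Norms of elements of [P] are divisible by r, and by polarization so is the trace of qconj x * y,
    which is the norm of x + y minus those of x and y. *)
Lemma integers_conj_div x y : P x -> P y -> integers (qconj x * y / r%:R).
Proof.
move=> Px Py; have Pxy := PD Px Py.
have [k1 h1] := qnm_in_ideal Px; have [k2 h2] := qnm_in_ideal Py.
have [k3 h3] := qnm_in_ideal Pxy.
have -> : (r%:R : F)^-1 = ((r%:R)^-1)%:E by rewrite fmorphV rmorph_nat.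
apply/integersP; rewrite !(qnmM s_sqrt F_gen d_neg)
  (qnm_conj s_sqrt F_gen d_neg).
rewrite (qnm_rat s_sqrt F_gen d_neg) h1 h2; split; last first.
  have -> : r%:R * k1%:~R * (r%:R * k2%:~R) * r%:R^-1 ^+ 2 =
    (k1 * k2)%:~R :> rat.
    by rewrite intrM; field.
  exact: intr_int.
have -> : qtr (qconj x * y * (r%:R^-1)%:E) = (qnm (x + y) - qnm x - qnm y) /
  r%:R.
  rewrite /quad_trace /quad_norm !(quadM s_sqrt F_gen d_neg,
    quadD s_sqrt F_gen d_neg, quad_conj s_sqrt F_gen d_neg).
  rewrite (qre_rat s_sqrt F_gen d_neg) (qim_rat s_sqrt F_gen d_neg); by field.
rewrite h1 h2 h3; have -> : (r%:R * k3%:~R - r%:R * k1%:~R - r%:R * k2%:~R) /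
  r%:R = (k3 - k1 - k2)%:~R :> rat.
  by rewrite !intrB; field.
exact: intr_int.
Qed.

(** Such a [y] has order -1 at [P] and no other pole. If r divides all of [P], take 1 / r; otherwise
    take qconj x / r for an x in [P] that r does not divide. *)
Lemma prime_ideal_inverse : exists2 y, ~ integers y & forall x, P x ->
  integers (y * x).
Proof.
have [[x Px xr]|no] := pselect (exists2 x, P x & ~ integers (x / r%:R)).
  exists (qconj x / r%:R); last by move=> y Py; rewrite mulrAC;
    apply: integers_conj_div.
  move=> /(qconj_integers s_sqrt F_gen d_neg); apply: contra_not xr.
  have -> : (r%:R : F)^-1 = ((r%:R)^-1)%:E by rewrite fmorphV rmorph_nat.
  by rewrite (qconjM s_sqrt F_gen d_neg) (qconj_rat s_sqrt F_gen d_neg)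
    (qconjK s_sqrt F_gen d_neg).
exists r%:R^-1; last first.
  by move=> x Px; rewrite mulrC; apply: contrapT => xr; apply: no; exists x.
have -> : (r%:R : F)^-1 = ((r%:R)^-1)%:E by rewrite fmorphV rmorph_nat.
move/(quad_rat_integers)/intrP => [k kr].
have : (r%:Z * k = 1)%R.
  by apply: (@intr_inj rat); rewrite intrM -kr mulfV.
by move/(congr1 absz)/eqP; rewrite abszM muln_eq1 absz_nat => /andP[/eqP r1];
  by move: r_pr; rewrite r1.
Qed.

End QuadraticPrimes.

(** * Elements of F that become squares in an unramified extension *)

Section Unramified.
Variables (F : fieldExtType rat) (L : splittingFieldType F).
Local Open Scope ring_scope.
Local Open Scope classical_set_scope.
Hypothesis L_unram : unramified_finite L.

Lemma integersA (x : F) : integers x -> integers (x%:A : L).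
Proof. by move/(@integers_in_alg F L x). Qed.

(* As [c] is a unit at [P], the last hypothesis puts [P] inside [Q^2] for the
   prime [Q] of [L] above [P], against the ramification index 1. *)
Lemma unramified_not_square (P : set F) (y c : F) (W : L) :
  maximal_ideal P -> P <> [set 0] ->
  ~ integers y -> (forall x, P x -> integers (y * x)) ->
  integers c -> ~ P c -> integers W ->
  submodule_gen (in_alg L @` P) (W ^+ 2) ->
  (forall x, P x -> exists2 t : L, integers t & (c * x)%:A = W ^+ 2 * t) ->
    False.
Proof.
move=> P_max Pn0 nIy yP Ic nPc IW PW cP.
have P_prime := maximal_ideal_prime P_max.
have [[P_sub P_int] P1 P_inv] := P_max; have [P0 PD PM] := P_sub.
set PL := submodule_gen _ in PW; have PL_sub : is_submodule PL
  by apply: submodule_genP.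
have PL_id : is_ideal PL.
  split=> //; apply: submodule_gen_sub; first exact: submodule_integers.
  by move=> _ [x /P_int Ix <-]; apply: integersA.
(* Multiplication by [y] maps [PL] into the integers, so 1 in [PL] would make [y] integral. *)
have PL1 : ~ PL 1.
  have : PL `<=` [set z | integers (y%:A * z)].
    apply: submodule_gen_sub; first exact: submodule_quotient
      (submodule_integers L).
    move=> _ [x Px <-] /=; rewrite mulr_algl scalerA; apply: integersA;
      exact: yP.
  by move=> h /h /=; rewrite mulr1 => /integers_in_alg.
have [Q Q_max PLQ] := exists_maximal_ideal PL_id PL1.
have Q_prime := maximal_ideal_prime Q_max.
have [[Q_sub Q_int] Q1 _] := Q_max; have [Q0 QD QM] := Q_sub.
have PQ x : P x -> Q x%:A by move=> Px; apply: PLQ; apply: sub_submodule_gen;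
  exists x.
have QP : lies_over Q P.
  apply/seteqP; split => x; first exact: PQ.
  move=> /= Qx; apply: contrapT => nPx; have Ix : integers x.
    by apply/(@integers_in_alg F L x); apply: Q_int.
  have [z Iz Pz] := P_inv x Ix nPx; apply: Q1.
  have -> : 1 = (1 - x * z)%:A + z%:A * x%:A :> L.
    by rewrite mulr_algl scalerA -scalerDl [z * x]mulrC subrK scale1r.
  by apply: QD; [apply: PQ | apply: QM => //; apply: integersA].
have [_] := L_unram P_prime Pn0 Q_prime QP; apply.
have [z Iz Pz] := P_inv c Ic nPc.
have Q2 u v t : Q u -> Q v -> integers t -> ideal_exp Q 2 (u * v * t).
  by move=> Qu Qv It; rewrite -mulrA; do 2!apply: mem_ideal_mul => //.
have [_ Q2D Q2M] : is_submodule (ideal_exp Q 2) by apply: submodule_ideal_mul.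
apply: submodule_gen_sub; first exact: submodule_ideal_mul.
move=> _ [x Px <-]; have [t It cx] := cP x Px.
have QW : Q W.
  have [_ _ QWW] := Q_prime; have := PLQ _ PW; rewrite expr2.
  by case/(QWW _ _ IW IW).
(* With z an inverse of c modulo P, the first term is a product of two elements of P, and the second
   is z c x = z W^2 t. *)
have -> : in_alg L x = x%:A * (1 - c * z)%:A * 1 + z%:A * (W * W * t).
  rewrite -expr2 -cx mulr1 !mulr_algl !scalerA -scalerDl; congr (_ *: _); ring.
apply: Q2D; first by apply: Q2; [apply: PQ | apply: PQ | apply: integers1].
by apply: Q2M; [apply: integersA | apply: Q2].
Qed.

Variables (s : F) (d : int).
Hypotheses (s_sqrt : s ^+ 2 = d%:~R) (F_gen : <<1;
  s>>%VS = {:F}%VS) (d_neg : d < 0).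

Local Notation "a %:E" := (rat_alg F a) : ring_scope.
Local Notation qre := (quad_re s_sqrt F_gen).
Local Notation qim := (quad_im s_sqrt F_gen).
Local Notation qtr := (quad_trace s_sqrt F_gen).
Local Notation qnm := (quad_norm s_sqrt F_gen).
Local Notation qconj := (quad_conjugate s_sqrt F_gen).
Local Notation integersP := (integersP s_sqrt F_gen d_neg).

(** If the square of [sqrt_ideal u] misses u, the ideal [b] that measures the defect lies in some
    maximal [P], and u has odd order at [P]. Then [w], times an element of F, gives a [W] whose
    square has order 1 at [P], which is ramification. *)
Lemma unramified_sqrt_full (u : F) (w : L) : u != 0 -> w ^+ 2 = u%:A ->
  ideal_mul (sqrt_ideal u) (sqrt_ideal u) u.
Proof.
move=> u0 w2; apply: contrapT => not_full.
have a_sub := submodule_sqrt_ideal u0.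
pose b : set F := [set z | ideal_mul (sqrt_ideal u) (sqrt_ideal u) (u * z)].
have b_sub : is_submodule b by apply/submodule_quotient/submodule_ideal_mul.
have b_id : is_ideal b.
  split=> // z bz; have -> : z = u * z / u by field.
  have : [set z | integers (z / u)] (u * z); last by [].
  apply: (ideal_mul_sub _ _ bz).
    have -> : [set z | integers (z / u)] = [set z | integers (u^-1 * z)].
      by apply/seteqP; split=> x /=; rewrite mulrC.
    exact/submodule_quotient/submodule_integers.
  by move=> x y ax ay /=; apply: sqrt_ideal_mul.
have b1 : ~ b 1 by rewrite /b /= mulr1.
have [P P_max bP] := exists_maximal_ideal b_id b1.
have [[P_sub P_int] P1 P_inv] := P_max; have [P0 PD PM] := P_sub.
have [_ _ P_prime] := maximal_ideal_prime P_max.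
have [[|m'] // _ Im] := integers_denominator s_sqrt F_gen d_neg u.
pose m : F := m'.+1%:R; have m0 : m != 0 by apply: natF_neq0.
have I_m : integers m by apply: integers_nat.
(* If u x^2 is integral, then u x lies in [sqrt_ideal u] and u x^2 in [b]. Hence u is never a square
   times a unit at P. *)
have am x : integers (u * x ^+ 2) -> P (u * x ^+ 2).
  move=> Ix; apply: bP; rewrite /b /=.
  have -> : u * (u * x ^+ 2) = u * x * (u * x) by ring.
  by apply: mem_ideal_mul; rewrite /sqrt_ideal /=;
    have -> : (u * x) ^+ 2 / u = u * x ^+ 2 by field.
have Pn0 : P <> [set 0].
  have Pum : P (u * m ^+ 2) by apply: am; rewrite expr2 mulrA [u * m]mulrC;
    apply: integersM.
  by move=> P0'; move: Pum; rewrite P0' /= => /eqP;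
    rewrite mulf_eq0 sqrf_eq0 (negbTE u0) (negbTE m0).
have [r r_pr Pr] := prime_in_ideal s_sqrt F_gen d_neg P_max Pn0.
have [y nIy yP] := prime_ideal_inverse s_sqrt F_gen d_neg P_max r_pr Pr.
pose a := u * m ^+ 2.
have a0 : a != 0 by rewrite mulf_neq0 ?sqrf_eq0.
have Ia : integers a by rewrite /a expr2 mulrA [u * m]mulrC; apply: integersM.
(* This n is the order of a at P: y^n a is integral but outside P. *)
have [n [Iyn nIyn]] : exists n, integers (y ^+ n * a) /\
  ~ integers (y ^+ n.+1 * a).
  apply: contrapT => no; apply: nIy;
    apply: (almost_integral s_sqrt F_gen d_neg a0) => n.
  rewrite mulrC; elim: n => [|n IH]; first by rewrite expr0 mul1r.
  by apply: contrapT => nI; apply: no; exists n.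
have nP : ~ P (y ^+ n * a) by move=> /yP; rewrite mulrA -exprS.
(* [pi] is a uniformizer at P, as y * pi is a unit there. *)
have [pi [Ppi nPpi]] : exists pi, P pi /\ ~ P (y * pi).
  apply: contrapT => no; have [x Px x0] : exists2 x, P x & x != 0.
    by exists r%:R => //; case: r r_pr {Pr} => // r' _; apply: natF_neq0.
  apply: nIy; apply: (almost_integral s_sqrt F_gen d_neg x0) => n';
    apply: P_int.
  rewrite mulrC; elim: n' => [|n' IH]; first by rewrite expr0 mul1r.
  by rewrite exprS -mulrA; apply: contrapT => nI; apply: no;
    exists (y ^+ n' * x).
have Iypi := yP _ Ppi.
have n_odd : odd n.
  apply: contrapT => /negP n_even; apply: nP.
  have e : y ^+ n * a = u * (m * y ^+ n./2) ^+ 2.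
    by rewrite -[in LHS](odd_double_half n) (negbTE n_even) add0n -muln2 exprM
      /a; ring.
  by rewrite e; apply: am; rewrite -e.
(* With n = 2k + 1, W^2 is pi times b' and y * pi, two units at P. Likewise c is a unit at P, and c
   x = W^2 (y x) for x in P. *)
pose b' := y ^+ n * a; pose k := n./2; pose c := b' * (y * pi) ^+ 2.
pose W := w * (m * y ^+ k.+1 * pi)%:A.
have W2 : W ^+ 2 = (b' * (y * pi) * pi)%:A.
  rewrite /W exprMn w2 -[(_ * pi)%:A ^+ 2](rmorphXn (in_alg L)) mulr_algl
    scalerA.
  have yn : y ^+ n = y * (y ^+ k) ^+ 2.
    have nk : n = (k * 2).+1 by rewrite muln2 -[LHS]odd_double_half n_odd.
    by rewrite [in LHS]nk exprS exprM.
  by congr (_ *: _); rewrite /b' yn /a [y ^+ k.+1]exprS; ring.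
have I_b' : integers b' by [].
have Ic : integers c by apply: integersM => //; apply: integersX.
have Ibpi : integers (b' * (y * pi)) by apply: integersM.
apply: (@unramified_not_square P y c W) => //.
- by rewrite /c expr2 => /(P_prime _ _ I_b' (integersM Iypi Iypi))[// |
  /(P_prime _ _ Iypi Iypi)[]].
- apply: integers_sqrt; rewrite W2; apply: integersA; apply: integersM => //;
  exact: P_int.
- rewrite W2; apply: sub_submodule_gen; exists (b' * (y * pi) * pi) => //;
  exact: PM.
move=> x Px; exists (y * x)%:A; first by apply: integersA; apply: yP.
by rewrite W2 mulr_algl scalerA; congr (_ *: _); rewrite /c; ring.
Qed.

(** Write x = A + B s: B is an integer because d is squarefree, and the even norm gives A and B the
    same parity. As d = 1 modulo 4, A^2 - d B^2 is then divisible by 4. *)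
Lemma half_integer (x : F) : squarefreez d -> (d = 1 %[mod 4])%Z ->
  (exists k : int, qtr x = 2%:R * k%:~R) ->
    (exists k : int, qnm x = 2%:R * k%:~R) ->
  integers (x / 2%:R).
Proof.
move=> d_sqf d1 [A hA] [N hN].
have [D dD] : exists D, d = 4 * D + 1 by exists (d %/ 4)%Z;
  rewrite {1}(divz_eq d 4) d1; lia.
have reA : qre x = A%:~R by move: hA; rewrite /quad_trace; lra.
have : qim x \is a Num.int.
  apply: (@squarefree_mul_sqr_int d) => //; first by rewrite lt_eqF.
  have -> : d%:~R * qim x ^+ 2 = (A ^+ 2 - 2 * N)%:~R.
    by move: hN; rewrite /quad_norm reA !intrD !intrN !intrM; lra.
  exact: intr_int.
case/intrP => B imB.
have e : A ^+ 2 - d * B ^+ 2 = 2 * N.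
  apply: (@intr_inj rat); rewrite [RHS]intrM -hN /quad_norm reA imB intrB
    [X in _ - X = _]intrM.
  by rewrite !rmorphXn.
have [C hC] : exists C, A = B + 2 * C.
  exists ((A - B) %/ 2)%Z.
  have : (2 %| (A - B))%Z.
    have : (2 %| (A - B) * (A - B))%Z.
      apply/dvdzP; exists (N + 2 * D * B ^+ 2 + B ^+ 2 - A * B); move: e;
        rewrite dD => e.
      by lia.
    by rewrite !dvdzE abszM Euclid_dvdM // orbb.
  by move/divzK; lia.
have -> : (2%:R : F)^-1 = ((2%:R)^-1)%:E by rewrite fmorphV rmorph_nat.
apply/integersP; rewrite (qnmM s_sqrt F_gen d_neg) (qnm_rat s_sqrt F_gen d_neg)
  hN.
rewrite /quad_trace (quadM s_sqrt F_gen d_neg) (qre_rat s_sqrt F_gen d_neg)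
  (qim_rat s_sqrt F_gen d_neg) reA.
split.
  have -> : 2%:R * (A%:~R * 2%:R^-1 + d%:~R * (qim x * 0)) = A%:~R :> rat
    by field.
  exact: intr_int.
have -> : 2%:R * N%:~R * 2%:R^-1 ^+ 2 = (C ^+ 2 + B * C - D * B ^+ 2)%:~R :>
  rat.
  have : 4 * (C ^+ 2 + B * C - D * B ^+ 2) = 2 * N by rewrite -e hC dD; ring.
  move/(congr1 (intr : int -> rat)); rewrite [LHS]intrM [RHS]intrM => h.
  move: h; set X := (X in _ * X = _) ;
    rewrite -[4%:~R]/(4%:R) -[2%:~R]/(2%:R) => h; lra.
exact: intr_int.
Qed.

(** Since (1 + z)^2 = 2 z, the ideal of 2 would become a square in L, whereas 2 has order 1 at each
    prime of F above it. *)
Lemma unramified_no_sqrtN1 (z : L) : squarefreez d -> (d = 1 %[mod 4])%Z ->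
  z ^+ 2 != -1.
Proof.
move=> d_sqf d1; apply/eqP => z2.
have I2 : is_ideal [set 2%:R * x | x in @integers F].
  split; first exact/submodule_scaled/submodule_integers.
  by move=> _ [x Ix <-]; apply: integersM => //; apply: integers_nat.
have n2 : (2%:R : F) != 0 by apply: natF_neq0.
have I21 : ~ [set 2%:R * x | x in @integers F] 1.
  case=> x Ix x2; have e : x = (2%:R^-1)%:E by rewrite fmorphV rmorph_nat;
    apply: (mulfI n2); rewrite x2 mulfV.
  move: Ix; rewrite e => /quad_rat_integers/intrP[k k2].
  have : 2 * k = 1 by apply: (@intr_inj rat); rewrite intrM -k2 mulfV.
  by lia.
have [P P_max twoP] := exists_maximal_ideal I2 I21.
have [[P_sub P_int] P1 P_inv] := P_max; have [P0 PD PM] := P_sub.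
have P2 : P 2%:R by apply: twoP; exists 1; rewrite ?mulr1 //; apply: integers1.
have Pn0 : P <> [set 0] by move=> e; move: P2; rewrite e /= => /eqP;
  rewrite (negbTE n2).
have two_pr : prime 2 by [].
have [y nIy yP] := prime_ideal_inverse s_sqrt F_gen d_neg P_max two_pr P2.
have Iz : integers z by apply: integers_sqrt; rewrite z2; apply: integersN;
  apply: integers1.
(* If 2 splits, c is an element of the conjugate of P outside P. If P is stable under conjugation,
   its elements have even trace and norm, hence are divisible by 2, and c = 1 works. *)
have [c Ic [nPc cP]] : exists2 c, integers c & ~ P c /\ forall x, P x ->
  integers (c * x / 2%:R).
  have [[x Px nPx]|no] := pselect (exists2 x, P x & ~ P (qconj x)).
    exists (qconj x); first by apply: (qconj_integers s_sqrt F_gen d_neg);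
      apply: P_int.
    by split=> // t Pt; apply: (integers_conj_div s_sqrt F_gen d_neg P_max
      two_pr P2).
  exists 1; first exact: integers1.
  split=> // x Px; rewrite mul1r; apply: half_integer => //; last first.
    by apply: (qnm_in_ideal s_sqrt F_gen d_neg P_max two_pr P2).
  have Pcx : P (qconj x) by apply: contrapT => nP; apply: no; exists x.
  have [/intrP[k xk] _] := (integersP x).1 (P_int _ Px).
  have /dvdzP[m km] : (2%N %| k)%Z.
    apply: (int_in_ideal P_max two_pr P2).
    have <- : x + qconj x = k%:~R
      by rewrite (qtrE s_sqrt F_gen d_neg) xk rmorph_int.
    exact: PD.
  by exists m; rewrite xk km intrM mulrC.
have W2 : (1 + z) ^+ 2 = 2%:R * z.
  have -> : (1 + z) ^+ 2 = 1 + 2%:R * z + z ^+ 2 by ring.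
  by rewrite z2; ring.
apply: (@unramified_not_square P y c (1 + z)) => //.
- by apply: integersD => //; apply: integers1.
- rewrite W2 mulrC; have [_ _ LM] := submodule_genP (in_alg L @` P);
  apply: LM => //.
  by apply: sub_submodule_gen; exists 2%:R; rewrite // rmorph_nat.
move=> x Px; exists (- z * (c * x / 2%:R)%:A).
  by apply: integersM; [apply: integersN | apply: integersA; apply: cP].
rewrite W2; have -> : 2%:R * z * (- z * (c * x / 2%:R)%:A) =
  - z ^+ 2 * (2%:R * (c * x / 2%:R)%:A) by ring.
have -> : (2%:R : L) = (2%:R)%:A by rewrite scaler_nat.
rewrite z2 opprK mul1r mulr_algl scalerA; congr (_ *: _); by field.
Qed.

End Unramified.

(** * Galois extensions of odd degree *)

Section OddDegree.
Variables (K : fieldType) (L : splittingFieldType K).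
Local Open Scope ring_scope.
Hypotheses (L_galois : galois 1%AS {:L}%AS) (two_neq0 : 2%:R != 0 :> L).
Local Notation G := ('Gal({:L} / 1))%g.

Lemma gal_invariant (x : L) : (forall g, g \in G -> g x = x) ->
  exists a : K, x = a%:A.
Proof.
move=> gx; have : x \in fixedField G by apply/fixedFieldP; rewrite ?memvf.
by rewrite (galois_fixedField L_galois) => /vlineP[a ->]; exists a.
Qed.

Hypothesis G_abelian : abelian G.
Hypothesis no_sqrt : forall (w : L) (u : K), w ^+ 2 = u%:A ->
  exists a : K, w = a%:A.

(** If the order were even, squaring would not be injective, and the squares would lie in a maximal
    subgroup [M]. For x fixed by [M] and moved by g, the element y = x - g x is fixed by [M] and
    negated by g. So its square lies in [K], hence so does y by [no_sqrt], against g y = -y. *)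
Lemma galois_group_odd : odd #|G|.
Proof.
apply: contraT => G_even.
have comm g h : g \in G -> h \in G -> (g * h = h * g)%g by move=> gG hG;
  apply: (centsP G_abelian).
pose S := [set (g ^+ 2)%g | g in G].
have S_group : group_set S.
  apply/group_setP; split; first by apply/imsetP; exists 1%g;
    rewrite ?group1 ?expg1n.
  move=> _ _ /imsetP[g gG ->] /imsetP[h hG ->]; apply/imsetP; exists (g * h)%g;
    first exact: groupM.
  by rewrite expgMn //; apply: comm.
have S_G : S \subset G by apply/fintype.subsetP => _ /imsetP[g gG ->];
  apply: groupX.
have SnG : S != G :> {set _}.
  have two_dvd : (2 %| #|G|)%N by rewrite dvdn2.
  have [g gG og] := Cauchy (isT : prime 2) two_dvd.
  suff : (#|S| < #|G|)%N by apply: contraTneq => ->; rewrite ltnn.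
  rewrite ltn_neqAle leq_imset_card andbT; apply/negP => /imset_injP inj.
  have g1 : g = 1%g by apply: inj => //; rewrite expg1n; apply/eqP;
    rewrite -order_dvdn og.
  by rewrite g1 order1 in og.
have [SG|[M M_max SM]] := @maximal_exists _ (Group S_group) _ S_G;
  first by case/eqP: SnG.
have [M_prop M_maxP] := maxgroupP M_max; have MG := proper_sub M_prop.
have [x xM [g gG gx]] : exists2 x : L, x \in fixedField M & exists2 g,
  g \in G & g x != x.
  have [y yM yF] : exists2 y : L, y \in fixedField M & y \notin 1%AS.
    apply/subvPn; apply: contraTN M_prop => sub1;
      rewrite properE negb_and negbK; apply/orP; right.
    by rewrite -(gal_fixedField M) galS.
  exists y => //; apply: contrapT => no; case/negP: yF.
  rewrite -(galois_fixedField L_galois); apply/fixedFieldP;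
    rewrite ?memvf // => g gG.
  by apply: contrapT => /eqP gy; apply: no; exists g.
have xP h : h \in M -> h x = x by move/fixedFieldP: xM;
  rewrite memvf => /(_ isT); apply.
have gM : g \notin M by apply: contraNN gx => /xP ->.
have galMx (a b : gal_of {:L}) (y : L) : (a * b)%g y = b (a y)
  by rewrite galM ?memvf.
have ggx : g (g x) = x.
  by rewrite -galMx; apply: xP; apply: (fintype.subsetP SM); apply/imsetP;
    exists g; rewrite // expgS expg1.
pose y := x - g x.
have gy : g y = - y by rewrite linearB /= ggx opprB.
have hy h : h \in M -> h y = y.
  move=> hM; have -> : h y = h x - h (g x) by rewrite linearB.
  rewrite (xP h hM) -galMx (comm g h) ?(fintype.subsetP MG _ hM) //.
  by rewrite galMx xP.
have [u yu] : exists u : K, y ^+ 2 = u%:A.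
  apply: gal_invariant => k kG.
  have H_group : group_set [set t in G | (t : gal_of {:L}) (y ^+ 2) == y ^+ 2].
    apply/group_setP; split; first by rewrite inE group1 gal_id eqxx.
    move=> a b; rewrite !inE => /andP[aG /eqP ay] /andP[bG /eqP yb].
    by rewrite groupM //= galMx ay yb.
  have gH : g \in Group H_group by rewrite inE gG rmorphXn /= gy sqrrN.
  have MH : M \subset Group H_group.
    by apply/fintype.subsetP => a aM;
      rewrite inE (fintype.subsetP MG) //= rmorphXn /= hy.
  have HG : Group H_group \subset G by apply/fintype.subsetP => a;
    rewrite inE => /andP[].
  have : ~~ (Group H_group \proper G).
    apply: contraNN gM => H_prop; by rewrite -(M_maxP _ H_prop MH).
  rewrite properE HG /= negbK => /fintype.subsetP/(_ k kG).
  by rewrite inE => /andP[_ /eqP].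
have [a ya] := no_sqrt yu; move: gy; rewrite ya rmorph_alg => /eqP.
rewrite -addr_eq0 -mulr2n -mulr_natl mulf_eq0 (negbTE two_neq0) /= -ya subr_eq0
  eq_sym.
by rewrite (negbTE gx).
Qed.
End OddDegree.

Section BinaryNorm.
Variable R : comPzRingType.
Local Open Scope ring_scope.

(* The multiplication of [R[X]/(X^2 - p)], with norm form [x^2 - p y^2]. *)
Definition sqrt_mul (p : R) (a b : R * R) : R * R :=
  (a.1 * b.1 + p * (a.2 * b.2), a.1 * b.2 + a.2 * b.1).

Fact sqrt_mulA p : associative (sqrt_mul p).
Proof. by move=> [? ?] [? ?] [? ?]; rewrite /sqrt_mul /=; congr pair; ring. Qed.
Fact sqrt_mulC p : commutative (sqrt_mul p).
Proof. by move=> [? ?] [? ?]; rewrite /sqrt_mul /=; congr pair; ring. Qed.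
Fact sqrt_mul1 p : left_id (1, 0) (sqrt_mul p).
Proof. by move=> [? ?]; rewrite /sqrt_mul /=; congr pair; ring. Qed.

HB.instance Definition _ p :=
  Monoid.isComLaw.Build (R * R)%type (1, 0) (sqrt_mul p) (@sqrt_mulA p)
    (@sqrt_mulC p) (@sqrt_mul1 p).

Definition sqrt_norm (p : R) (a : R * R) : R := a.1 ^+ 2 - p * a.2 ^+ 2.

Lemma sqrt_normM p : {morph sqrt_norm p : a b / sqrt_mul p a b >-> a * b}.
Proof. by move=> [? ?] [? ?]; rewrite /sqrt_norm /sqrt_mul /=; ring. Qed.

Lemma sqrt_norm1 p : sqrt_norm p (1, 0) = 1.
Proof. by rewrite /sqrt_norm /=; ring. Qed.
End BinaryNorm.

Section OddNorm.
Variables (K : fieldType) (L : splittingFieldType K).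
Local Open Scope ring_scope.
Hypothesis L_galois : galois 1%AS {:L}%AS.
Local Notation G := ('Gal({:L} / 1))%g.
Hypothesis G_odd : odd #|G|.

(* Multiply the conjugates of the representation, and divide by the even power
   of [q]. *)
Lemma odd_degree_norm (p q : K) (u v : L) :
  q != 0 -> q%:A = u ^+ 2 - p%:A * v ^+ 2 -> exists a b : K,
    q = a ^+ 2 - p * b ^+ 2.
Proof.
move=> q0 quv; pose z (g : gal_of {:L}) := (g u, g v).
pose Z := \big[sqrt_mul (p%:A : L)/(1, 0)]_(g in G) z g.
have Z_norm : sqrt_norm p%:A Z = q%:A ^+ #|G|.
  rewrite (big_morph _ (sqrt_normM _) (sqrt_norm1 _)) -prodr_const;
    apply: eq_bigr => g gG.
  rewrite /sqrt_norm; transitivity (g (u ^+ 2 - p%:A * v ^+ 2)).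
    rewrite rmorphB; congr (_ - _); first by rewrite rmorphXn.
    by rewrite rmorphM rmorphXn /= rmorph_alg.
  by rewrite -quv rmorph_alg.
have Z_inv h : h \in G -> (h Z.1, h Z.2) = Z.
  move=> hG; pose f (a : L * L) := (h a.1, h a.2).
  have fM : {morph f : a b / sqrt_mul (p%:A : L) a b}.
    move=> a b; rewrite /f /sqrt_mul /= !rmorphD !rmorphM /= rmorph_alg; done.
  have f1 : f (1, 0) = (1, 0) by rewrite /f /= rmorph1 rmorph0.
  rewrite -/(f Z) /Z (big_morph _ fM f1) [RHS](reindex_inj (mulIg h)) /=.
  apply: eq_big => g; first by rewrite groupMr.
  by move=> gG; rewrite /f /z /= !galM ?memvf.
have [a aZ] : exists a : K, Z.1 = a%:A.
  by apply: (gal_invariant L_galois) => h hG; rewrite -[in RHS](Z_inv h hG).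
have [b bZ] : exists b : K, Z.2 = b%:A.
  by apply: (gal_invariant L_galois) => h hG; rewrite -[in RHS](Z_inv h hG).
pose m := #|G|./2; have qm : q ^+ m != 0 by rewrite expf_neq0.
have key : q * (q ^+ m) ^+ 2 = a ^+ 2 - p * b ^+ 2.
  rewrite -exprM -exprS; have -> : (m * 2).+1 = #|G|.
    by rewrite muln2 -[RHS]odd_double_half G_odd.
  apply: (fmorph_inj (in_alg L));
    rewrite rmorphXn rmorphB rmorphXn [X in _ = _ - X]rmorphM rmorphXn /=.
  by rewrite -Z_norm /sqrt_norm aZ bZ.
move: (q ^+ m) qm key => c c0 key; exists (a / c), (b / c).
rewrite !expr_div_n mulrA -mulrBl -key mulfK // sqrf_eq0 //.
Qed.
End OddNorm.

(** * Quaternion algebras *)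

Section QuaternionNorm.
Variable K : fieldType.
Local Open Scope ring_scope.
Hypothesis two_neq0 : 2%:R != 0 :> K.
Implicit Types p q : K.

Definition is_norm p q := exists u v : K, q = u ^+ 2 - p * v ^+ 2.

(** The form factors as (u - r v)(u + r v); the witnesses make the factors 1 and q. *)
Lemma is_norm_of_square p q : p != 0 -> (exists r, p = r ^+ 2) -> is_norm p q.
Proof.
move=> p0 [r pr]; have r0 : r != 0 by apply: contraNneq p0 => r0;
  rewrite pr r0 expr0n.
by exists ((q + 1) / 2%:R), ((q - 1) / (2%:R * r)); rewrite pr; field;
  rewrite r0.
Qed.

Lemma is_norm_sym p q : p != 0 -> is_norm q p -> is_norm p q.
Proof.
move=> p0 [u [v puv]]; have [v0|v0] := eqVneq v 0.
  by apply: is_norm_of_square => //; exists u;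
    rewrite puv v0 expr0n mulr0 subr0.
by exists (u / v), v^-1; rewrite puv; field.
Qed.

(** If q = u^2 - p v^2, then u + v i + j is a zero divisor. Conversely a nonzero element of reduced
    norm N = 0 makes q a quotient of two norms, hence a norm, unless the denominator vanishes; then
    p is a square and everything is a norm. *)
Lemma quat_division_norm p q : p != 0 ->
  is_division_ring (quat p q) <-> ~ is_norm p q.
Proof.
move=> p0; split=> [H_div [u [v quv]] | no_norm].
  pose x : quat p q := Quat p q u v 1 0;
    pose x' : quat p q := Quat p q u (- v) (-1) 0.
  have x0 : x != 0 by apply/eqP => /(congr1 (@q2 _ _ _))/= /eqP;
    rewrite oner_eq0.
  have xx' : x * x' = 0.
    by rewrite /x /x'; congr Quat; rewrite /= ?quv; ring.
  have [y [_ yx]] := H_div x x0.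
  have : x' = 0 by rewrite -[x']mul1r -yx -mulrA xx' mulr0.
  by move=> /(congr1 (@q2 _ _ _))/= /eqP; rewrite oppr_eq0 oner_eq0.
case=> x0 x1 x2 x3 xn0; pose N := x0 ^+ 2 - p * x1 ^+ 2 - q * x2 ^+ 2 +
  p * q * x3 ^+ 2.
have N0 : N != 0.
  apply/eqP => N0; apply: no_norm.
  have e : x0 ^+ 2 - p * x1 ^+ 2 = q * (x2 ^+ 2 - p * x3 ^+ 2).
    by apply/eqP; rewrite -subr_eq0; apply/eqP; rewrite -[RHS]N0 /N; ring.
  have [D0|D0] := eqVneq (x2 ^+ 2 - p * x3 ^+ 2) 0; last first.
    pose D := x2 ^+ 2 - p * x3 ^+ 2.
    exists ((x0 * x2 - p * (x1 * x3)) / D), ((x1 * x2 - x0 * x3) / D).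
    rewrite !expr_div_n [p * (_ / _)]mulrA -mulrBl.
    have -> : (x0 * x2 - p * (x1 * x3)) ^+ 2 - p * (x1 * x2 - x0 * x3) ^+ 2 =
       (x0 ^+ 2 - p * x1 ^+ 2) * D by rewrite /D; ring.
    by rewrite e -/D; field.
  move: e; rewrite D0 mulr0 => /eqP; rewrite subr_eq0 => /eqP e.
  move/eqP: D0; rewrite subr_eq0 => /eqP e'.
  apply: is_norm_of_square => //.
  have [z1|n1] := eqVneq x1 0; last by exists (x0 / x1);
    rewrite expr_div_n e mulfK // sqrf_eq0.
  have [z3|n3] := eqVneq x3 0; last by exists (x2 / x3);
    rewrite expr_div_n e' mulfK // sqrf_eq0.
  move: e e'; rewrite z1 z3 expr0n mulr0 => /eqP;
    rewrite sqrf_eq0 => /eqP z0 /eqP.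
  rewrite sqrf_eq0 => /eqP z2; case/eqP: xn0; by rewrite z0 z1 z2 z3.
exists (Quat p q (x0 / N) (- x1 / N) (- x2 / N) (- x3 / N)).
by split; congr Quat; rewrite /=; move: N0; rewrite /N => N0; field.
Qed.
End QuaternionNorm.

(** * Infinite descent at a prime that splits in F *)

Section SplitPrime.
Variables (F : fieldExtType rat) (s : F) (d : int).
Local Open Scope ring_scope.
Local Open Scope classical_set_scope.
Hypotheses (s_sqrt : s ^+ 2 = d%:~R) (F_gen : <<1;
  s>>%VS = {:F}%VS) (d_neg : d < 0).
Local Notation "a %:E" := (rat_alg F a) : ring_scope.
Local Notation qre := (quad_re s_sqrt F_gen).
Local Notation qim := (quad_im s_sqrt F_gen).
Variables (p : nat) (q r : int).
Hypotheses (p_pr : prime p) (p_odd : odd p) (r_sqrt : (p %| r ^+ 2 - d)%Z)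
  (pr : ~~ (p %| r)%Z).
Hypothesis q_nonres : legendre q p = -1.

(* [x] lies in [Z[s]] and reduces to [a] modulo the prime [(p, s - r)]. *)
Definition reduces_to (x : F) (a : int) : Prop :=
  exists A B : int, x = A%:~R + B%:~R * s /\ (p %| a - (A + r * B))%Z.

Lemma reduces_int n : reduces_to n%:~R n.
Proof. by exists n, 0; rewrite mul0r mulr0 !addr0 subrr dvdz0. Qed.

Lemma reducesD x y a b : reduces_to x a -> reduces_to y b ->
  reduces_to (x + y) (a + b).
Proof.
move=> [A [B [-> h]]] [A' [B' [-> h']]]; exists (A + A'), (B + B'); split.
  by rewrite !intrD; ring.
have -> : a + b - (A + A' + r * (B + B')) = (a - (A + r * B)) +
  (b - (A' + r * B')) by ring.
exact: rpredD.
Qed.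

Lemma reducesM x y a b : reduces_to x a -> reduces_to y b ->
  reduces_to (x * y) (a * b).
Proof.
move=> [A [B [-> h]]] [A' [B' [-> h']]]; exists (A * A' + d * (B * B')),
  (A * B' + B * A'); split.
  rewrite !intrD; have -> : (A * A')%:~R = A%:~R * A'%:~R :> F by rewrite intrM.
  by rewrite 4!intrM -s_sqrt; ring.
have -> : a * b - (A * A' + d * (B * B') + r * (A * B' + B * A')) =
  (a - (A + r * B)) * b + (b - (A' + r * B')) * (A + r * B) +
    (r ^+ 2 - d) * (B * B') by ring.
by rewrite !rpredD ?dvdz_mulr.
Qed.

Lemma reduces_uniq x a b : reduces_to x a -> reduces_to x b -> (p %| a - b)%Z.
Proof.
move=> [A [B [xE h]]] [A' [B' [xE' h']]].
have [e1 e2] : A%:~R = A'%:~R :> rat /\ B%:~R = B'%:~R :> rat.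
  apply: (quad_uniq s_sqrt d_neg); by rewrite !rmorph_int -xE -xE'.
have {}e1 : A = A' by apply: (@intr_inj rat). have {}e2 : B = B'
  by apply: (@intr_inj rat).
have -> : a - b = (a - (A + r * B)) - (b - (A' + r * B')) by rewrite e1 e2;
  ring.
exact: rpredB.
Qed.

(** The only pole of [y] is at the prime (p, s - r): there s + r reduces to 2r, a unit, while it
    lies in the conjugate prime (p, s + r). *)
Let y : F := (s + r%:~R) / p%:R.
Let p0 : (p%:R : F) != 0.
Proof. by case: (p) p_pr => // n _; apply: natF_neq0. Qed.

Lemma reduces_s : reduces_to s r.
Proof. by exists 0, 1; rewrite add0r mul1r add0r mulr1 subrr dvdz0. Qed.

Lemma reduces_div x a : reduces_to x a -> (p %| a)%Z ->
  exists b, reduces_to (y * x) b.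
Proof.
move=> [A [B [-> h]]] pa.
have /dvdzP[k hk] : (p %| A + r * B)%Z by rewrite -(subKr a (A + r * B)) rpredB.
have /dvdzP[m hm] := r_sqrt.
(* The product (s + r)(A + B s) has coordinates r (A + r B) - (r^2 - d) B and A + r B, both
   divisible by p. *)
pose A' := r * k - m * B; exists (A' + r * k), A', k; split;
  last by rewrite subrr dvdz0.
apply: (mulfI p0); rewrite /y mulrA mulrCA divff // mulr1.
have e1 : (A + r * B)%:~R = k%:~R * p%:R :> F by rewrite hk intrM.
have e2 : r%:~R ^+ 2 - d%:~R = m%:~R * p%:R :> F
  by rewrite -rmorphXn -intrB hm intrM.
have e3 : A'%:~R = r%:~R * k%:~R - m%:~R * B%:~R :> F by rewrite intrB;
  congr (_ - _); apply: intrM.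
have e4 : (A + r * B)%:~R = A%:~R + r%:~R * B%:~R :> F by rewrite intrD;
  congr (_ + _); apply: intrM.
transitivity (r%:~R * (k%:~R * p%:R) - (m%:~R * p%:R) * B%:~R +
  (k%:~R * p%:R) * s); last first.
  by rewrite e3; ring.
by rewrite -e1 -e2 e4 -s_sqrt; ring.
Qed.

Lemma split_descent X Y Z a b c :
  reduces_to X a -> reduces_to Y b -> reduces_to Z c ->
  X ^+ 2 = p%:R * Y ^+ 2 + q%:~R * Z ^+ 2 ->
  exists a' b' c', [/\ reduces_to (y * X) a',
    reduces_to (y * Y) b' & reduces_to (y * Z) c'].
Proof.
move=> Xa Yb Zc e.
have pc : (p %| a ^+ 2 - q * c ^+ 2)%Z.
  have h1 : reduces_to (X * X) (a * a) by apply: reducesM.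
  have h2 : reduces_to (X * X) (p%:Z * (b * b) + q * (c * c)).
    rewrite -expr2 e; apply: reducesD; last by rewrite expr2;
      apply: reducesM (reduces_int _) (reducesM _ _).
    by rewrite expr2; apply: reducesM (reduces_int p) (reducesM _ _).
  have := reduces_uniq h1 h2.
  have -> : a * a - (p%:Z * (b * b) + q * (c * c)) =
    a ^+ 2 - q * c ^+ 2 - p%:Z * b ^+ 2 by ring.
  by move=> h; rewrite -(subrK (p%:Z * b ^+ 2) (_ - _)) rpredD // dvdz_mulr.
have [pa pz] := legendreN1_anisotropic p_pr p_odd q_nonres pc.
have [a' Xa'] := reduces_div Xa pa; have [c' Zc'] := reduces_div Zc pz.
have sr : reduces_to (s + r%:~R) (r + r) := reducesD reduces_s (reduces_int r).
(* Multiplying the equation by p y^2 gives ((s + r) Y)^2 on one side and p times an element of Z[s]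
   on the other, so p divides (2 r b)^2. *)
have pb : (p %| b)%Z.
  have h1 : reduces_to (((s + r%:~R) * (s + r%:~R)) * (Y * Y))
    ((r + r) * (r + r) * (b * b)).
    by apply: reducesM; apply: reducesM.
  have h2 : reduces_to (p%:R * (y * X * (y * X) +
    (- q)%:~R * (y * Z * (y * Z))))
     (p%:Z * (a' * a' + - q * (c' * c'))).
    apply: reducesM (reduces_int p) _; apply: reducesD; first exact: reducesM.
    by apply: reducesM (reduces_int _) _; apply: reducesM.
  have e2 : (s + r%:~R) * (s + r%:~R) * (Y * Y) =
    p%:R * (y * X * (y * X) + (- q)%:~R * (y * Z * (y * Z))).
    have -> : p%:R * (y * X * (y * X) + (- q)%:~R * (y * Z * (y * Z))) =
      p%:R * y ^+ 2 * (X ^+ 2 - q%:~R * Z ^+ 2).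
      by rewrite intrN; ring.
    by rewrite e addrK /y; field.
  rewrite e2 in h1; have := reduces_uniq h1 h2.
  have -> : (r + r) * (r + r) * (b * b) - p%:Z * (a' * a' + - q * (c' * c')) =
    (2 * r * b) * (2 * r * b) - p%:Z * (a' * a' + - q * (c' * c')) by ring.
  move=> h; have {}h : (p %| (2 * r * b) * (2 * r * b))%Z.
    by rewrite -(subrK (p%:Z * (a' * a' + - q * (c' * c'))) (_ * _)) rpredD //
      dvdz_mulr.
  move: h pr; rewrite !dvdzE !abszM !Euclid_dvdM // absz_nat orbb =>
    /orP[/orP[|->//]|//].
  by move=> /dvdn_leq => /(_ isT); have := prime_gt1 p_pr;
    case: (p) p_odd => [|[|[|]]].
have [b' Yb'] := reduces_div Yb pb.
by exists a', b', c'.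
Qed.

Lemma split_descent_iter (X Y Z : F) :
  (exists a b c, [/\ reduces_to X a, reduces_to Y b & reduces_to Z c]) ->
  X ^+ 2 = p%:R * Y ^+ 2 + q%:~R * Z ^+ 2 -> forall n,
  exists a b c, [/\ reduces_to (y ^+ n * X) a,
    reduces_to (y ^+ n * Y) b & reduces_to (y ^+ n * Z) c].
Proof.
move=> h0 e; elim=> [|n [a [b [c [Xa Yb Zc]]]]]; first by rewrite expr0 !mul1r.
rewrite exprS -!(mulrA y); apply: split_descent Xa Yb Zc _.
by rewrite exprMn e; ring.
Qed.

Lemma reduces_integers x a : reduces_to x a -> integers x.
Proof.
move=> [A [B [-> _]]]; apply: integersD; first exact: integers_int.
by apply: integersM; [apply: integers_int | apply: s_integer s_sqrt].
Qed.

Lemma split_nonintegral : ~ integers y.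
Proof.
move/(integersP s_sqrt F_gen d_neg) => [+ _].
have -> : y = (r%:~R / p%:R)%:E + (p%:R^-1)%:E * s.
  by rewrite rmorphM fmorphV rmorph_int rmorph_nat /y; field.
rewrite /quad_trace (qreE s_sqrt F_gen d_neg) => /intrP[k hk].
have pn : (p%:R : rat) != 0 by rewrite pnatr_eq0 -lt0n prime_gt0.
have : 2 * r = k * p%:Z.
  by apply: (@intr_inj rat); rewrite [LHS]intrM [RHS]intrM -hk -[2%:~R]/(2%:R);
    field.
move=> h; have : (p %| 2 * r)%Z by rewrite h dvdz_mull.
move: pr; rewrite !dvdzE abszM Euclid_dvdM // => /negbTE-> /orP[|//].
by move=> /dvdn_leq => /(_ isT); have := prime_gt1 p_pr;
  case: (p) p_odd => [|[|[|]]].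
Qed.

(** The free factor [k] allows one common denominator for three elements. *)
Lemma reduces_denominator (x : F) : exists m : nat, (0 < m)%N /\
  forall k : nat, exists a, reduces_to ((m * k)%N%:R * x) a.
Proof.
pose m := (`|denq (qre x)| * `|denq (qim x)|)%N; exists m; split.
  by rewrite muln_gt0 !absz_gt0 !denq_neq0.
have dq a : ((`|denq a|%N)%:R * a)%:E = (numq a)%:~R.
  by rewrite -(rmorph_int (rat_alg F)) numqE mulrC pmulrn absz_denq.
move=> k; pose A := numq (qre x) * (`|denq (qim x)| * k)%N%:Z;
  pose B := numq (qim x) * (`|denq (qre x)| * k)%N%:Z.
exists (A + r * B), A, B; rewrite subrr dvdz0; split=> //.
have eA : A%:~R = (`|denq (qre x)|%N%:R * qre x)%:E *
  (`|denq (qim x)| * k)%N%:R by rewrite dq /A intrM.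
have eB : B%:~R = (`|denq (qim x)|%N%:R * qim x)%:E *
  (`|denq (qre x)| * k)%N%:R by rewrite dq /B intrM.
rewrite {1}(quadE s_sqrt F_gen x) eA eB /m; move: (qre x) (qim x) => a b.
by rewrite !natrM !rmorphM !rmorph_nat /=; ring.
Qed.

(* A solution stays in [Z[s]] when multiplied by any power of the non-integer
   [(s + r) / p]. *)
Theorem split_prime_anisotropic (X Y Z : F) :
  X ^+ 2 = p%:R * Y ^+ 2 + q%:~R * Z ^+ 2 -> [/\ X = 0, Y = 0 & Z = 0].
Proof.
move=> e; have [m1 [m1_gt0 h1]] := reduces_denominator X.
have [m2 [m2_gt0 h2]] := reduces_denominator Y;
  have [m3 [m3_gt0 h3]] := reduces_denominator Z.
pose m := (m1 * m2 * m3)%N.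
have h0 : exists a b c, [/\ reduces_to (m%:R * X) a,
  reduces_to (m%:R * Y) b & reduces_to (m%:R * Z) c].
  have [a ha] := h1 (m2 * m3)%N; have [b hb] := h2 (m1 * m3)%N;
    have [c hc] := h3 (m1 * m2)%N.
  exists a, b, c; split; rewrite /m; first by rewrite -mulnA.
    by rewrite [(m1 * m2)%N]mulnC -mulnA.
  by rewrite mulnC.
have e' : (m%:R * X) ^+ 2 = p%:R * (m%:R * Y) ^+ 2 + q%:~R * (m%:R * Z) ^+ 2.
  by rewrite exprMn e; ring.
have m0 : (m%:R : F) != 0.
  have : (0 < m)%N by rewrite !muln_gt0 m1_gt0 m2_gt0.
  by case: (m) => // n _; apply: natF_neq0.
have H := split_descent_iter h0 e'.
have zero T : (forall n, exists a, reduces_to (y ^+ n * (m%:R * T)) a) -> T = 0.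
  move=> hT; apply/eqP/negPn/negP => T0; apply: split_nonintegral.
  apply: (almost_integral s_sqrt F_gen d_neg (c := m%:R * T));
    first by rewrite mulf_neq0.
  by move=> n; have [a ha] := hT n; rewrite mulrC; apply: reduces_integers ha.
by split; apply: zero => n; have [a [b [c [ha hb hc]]]] := H n;
  [exists a|exists b|exists c].
Qed.
End SplitPrime.

(** * Representing q as a norm when neither prime splits *)

Section NonsplitPrimes.
Variables (F : fieldExtType rat) (s : F) (l p q : nat).
Local Open Scope ring_scope.
Hypotheses (s_sqrt : s ^+ 2 = (- l%:Z)%:~R) (l_pr : prime l)
  (l3 : (l %% 4 = 3)%N).
Hypotheses (p_pr : prime p) (q_pr : prime q) (p_odd : odd p) (q_odd : odd q).
Hypothesis p_neq_q : p != q.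

Let intF_neq0 (n : int) : n != 0 -> (n%:~R : F) != 0.
Proof. by move=> n0; rewrite -(rmorph_int (rat_alg F)) fmorph_eq0 intr_eq0. Qed.

(* [-1] is the norm of [(a + sqrt p) / b], where [p = a^2 + b^2]. *)
Lemma nonsplit_primes_norm : (p %% 4 = 1)%N -> legendre p q = -1 ->
  legendre (- l%:Z) p <> 1 -> legendre (- l%:Z) q <> 1 ->
    is_norm (p%:R : F) q%:R.
Proof.
move=> p1 pqN lp lq.
have [a [b pab]] := prime_sum_two_squares p_pr p1.
have b0 : b != 0.
  apply/eqP => b0; case/eqP: (prime_not_rat_sqr a%:~R p_pr).
  by have := congr1 (intr : int -> rat) pab; rewrite b0 expr0n addr0 rmorphXn.
have bF : (b%:~R : F) != 0 by apply: intF_neq0.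
have pF : (p%:R : F) = a%:~R ^+ 2 + b%:~R ^+ 2.
  by have := congr1 (intr : int -> F) pab;
    rewrite intrD [X in X + _]rmorphXn [X in _ + X]rmorphXn.
have [ql|ql] := eqVneq q l.
  (* Here q = -s^2, and the witnesses are s times those of -1. *)
  exists (a%:~R / b%:~R * s), (s / b%:~R).
  have -> : (q%:R : F) = - s ^+ 2 by rewrite s_sqrt intrN opprK ql.
  by rewrite pF; field.
have [pl|pl] := eqVneq p l; first by move: p1; rewrite pl l3.
have l_odd : odd l by move: l3; clear; lia.
have ndiv (n : nat) : prime n -> odd n -> n != l -> legendre (- l%:Z) n != 0.
  by move=> n_pr n_odd nl; rewrite legendre_eq0 // rpredN dvdzE /= dvdn_prime2.
have lpN : legendre (- l%:Z) p = -1.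
  by case: (legendre_cases p_pr p_odd (- l%:Z)) (ndiv p p_pr p_odd pl) =>
    [-> //| // |].
have lqN : legendre (- l%:Z) q = -1.
  by case: (legendre_cases q_pr q_odd (- l%:Z)) (ndiv q q_pr q_odd ql) =>
    [-> //| // |].
have qpN : legendre q p = -1 by rewrite -(legendre_reciprocity1 p_pr q_pr).
have plN : legendre p l = -1 by rewrite -(legendre_reciprocity3 l_pr p_pr) //
  eq_sym.
have qlN : legendre q l = -1 by rewrite -(legendre_reciprocity3 l_pr q_pr) //
  eq_sym.
have [x [y [z [xyz0 e]]]] : exists x y z : int, (x, y, z) != (0, 0, 0) /\
  p%:Z * x ^+ 2 + l%:Z * y ^+ 2 = q%:Z * z ^+ 2.
  (* Each condition is a product of two nonresidues; modulo p there is the further factor -1, a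
     residue. *)
  apply: legendre_conic => //; first by rewrite eq_sym.
  - have -> : l%:Z * q%:Z = (-1) * ((- l%:Z) * q%:Z) by ring.
    by rewrite !legendreM // legendreN1 // p1 lpN qpN.
  - by rewrite legendreM // plN qlN.
  have -> : - (p%:Z * l%:Z) = p%:Z * - l%:Z by ring.
  by rewrite legendreM // pqN lqN.
have z0 : z != 0.
  apply: contraNneq xyz0 => z0; move: e; rewrite z0 expr0n mulr0 => /eqP.
  have pp := prime_gt0 p_pr; have lp0 := prime_gt0 l_pr.
  have hx : 0 <= p%:Z * x ^+ 2 by rewrite mulr_ge0 ?sqr_ge0.
  have hy : 0 <= l%:Z * y ^+ 2 by rewrite mulr_ge0 ?sqr_ge0.
  rewrite paddr_eq0 // !mulf_eq0 !eqz_nat !gtn_eqF //= !orbb.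
  by move=> /andP[/eqP-> /eqP->].
have zF : (z%:~R : F) != 0 by apply: intF_neq0.
have eF : p%:R * x%:~R ^+ 2 - s ^+ 2 * y%:~R ^+ 2 = q%:R * z%:~R ^+ 2 :> F.
  have := congr1 (intr : int -> F) e; rewrite s_sqrt intrN mulNr opprK intrD.
  by rewrite [X in X + _]intrM [X in _ + X]intrM [RHS]intrM !rmorphXn.
(* As l = -s^2, the conic gives (s y + x sqrt p) / z the norm -q. The witnesses are the coordinates
   of its product with (a + sqrt p) / b, of norm -1. *)
exists (a%:~R / b%:~R * (s * y%:~R / z%:~R) + p%:R / b%:~R * (x%:~R / z%:~R)),
  (a%:~R / b%:~R * (x%:~R / z%:~R) + b%:~R^-1 * (s * y%:~R / z%:~R)).
have -> : (q%:R : F) = (p%:R * x%:~R ^+ 2 - s ^+ 2 * y%:~R ^+ 2) / z%:~R ^+ 2.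
  by rewrite eF mulfK // sqrf_eq0.
by rewrite pF; field; rewrite zF.
Qed.

End NonsplitPrimes.

Local Open Scope ring_scope.

Theorem proposition6p6 (l : nat) (d : int)
    (F : fieldExtType rat) (s : F) (L : splittingFieldType F) (p q : nat)
    (l_prime : prime l) (l_odd : odd l)
    (d_squarefree : squarefreez d) (d_neq1 : d <> 1)
    (s_sqrt : s ^+ 2 = d%:~R) (F_gen : <<1; s>>%VS = {:F}%VS)
    (F_imaginary : d < 0)
    (F_class_number : has_class_number F l)
    (L_hilbert : is_hilbert_class_field L)
    (p_prime : prime p) (p_odd : odd p) (q_prime : prime q) (q_odd : odd q)
    (p_neq_q : p <> q)
    (pq_nonresidue : legendre p%:Z q = -1)
    (pq_mod4 : p = 1 %[mod 4] \/ q = 1 %[mod 4]) :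
  is_division_ring (quat (p%:R : L) (q%:R : L)) <->
  legendre (quad_disc d) p = 1 \/ legendre (quad_disc d) q = 1.
Proof.
have [[L_galois L_abelian L_unram _] _] := L_hilbert.
have [r [r_pr r3 dr]] := odd_class_number_disc s_sqrt F_gen F_imaginary
  d_squarefree l_odd (prime_gt1 l_prime) F_class_number.
have d1 : (d = 1 %[mod 4])%Z by move: r3; rewrite dr; clear; lia.
have -> : quad_disc d = d by rewrite /quad_disc d1 eqxx.
have pq : p != q by apply/eqP.
have qp : q != p by rewrite eq_sym.
(* One of the primes is 1 modulo 4, so reciprocity makes the hypothesis symmetric in p and q. *)
have qpN : legendre q p = (-1).
  by case: pq_mod4 => h; [rewrite -(legendre_reciprocity1 p_prime q_prime) |
    rewrite (legendre_reciprocity1 q_prime p_prime)].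
have F_nat (n : nat) : (n%:R == 0 :> F) = (n == 0)%N.
  by case: n => [|n]; rewrite ?eqxx //; apply/negbTE/natF_neq0.
have L_nat (n : nat) : (n%:R == 0 :> L) = (n == 0)%N.
  by rewrite -F_nat -(rmorph_nat (in_alg L)) fmorph_eq0.
have L2 : (2%:R != 0 :> L) by rewrite L_nat.
have pL : (p%:R != 0 :> L) by rewrite L_nat -lt0n prime_gt0.
have pF : (p%:R != 0 :> F) by rewrite F_nat -lt0n prime_gt0.
have qF : (q%:R != 0 :> F) by rewrite F_nat -lt0n prime_gt0.
rewrite quat_division_norm //; split=> [no_norm | split_pq [u [v quv]]].
  apply: contrapT => nonsplit; apply: no_norm.
  have [a [b qab]] : is_norm (p%:R : F) q%:R.
    have lp : legendre d p <> 1 by move=> h; apply: nonsplit; left.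
    have lq : legendre d q <> 1 by move=> h; apply: nonsplit; right.
    rewrite dr in s_sqrt lp lq; case: pq_mod4 => h.
      exact: (nonsplit_primes_norm s_sqrt).
    apply: is_norm_sym => //; first exact: natF_neq0.
    exact: (nonsplit_primes_norm s_sqrt).
  exists (a%:A), (b%:A); rewrite -(rmorph_nat (in_alg L) q) qab.
  by rewrite rmorphB rmorphXn [X in (_ - X)]rmorphM rmorphXn /= scaler_nat.
have no_sqrt (w : L) (x : F) : (w ^+ 2 = x%:A) -> exists a : F, (w = a%:A).
  move=> w2; have [x0|x0] := eqVneq x 0.
    by exists 0; apply/eqP; rewrite scale0r -sqrf_eq0 w2 x0 scale0r.
  have noN1 := unramified_no_sqrtN1 L_unram s_sqrt F_gen F_imaginary _
    d_squarefree d1.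
  have x_full := unramified_sqrt_full L_unram s_sqrt F_gen F_imaginary x0 w2.
  have alg_sqr (t : F) : ((t ^+ 2)%:A = t%:A ^+ 2 :> L)
    by apply: (rmorphXn (in_alg L)).
  case: (class_square s_sqrt F_gen F_imaginary l_odd F_class_number x0 x_full)
    => [[t xt]|[t xt]|[t t2]].
  - move: w2 => /eqP; rewrite xt alg_sqr eqf_sqr => /orP[] /eqP ->;
    first by exists t.
    by exists (- t); rewrite scaleNr.
  - have t0 : (t%:A != 0 :> L).
      by rewrite -sqrf_eq0 -alg_sqr; move: x0;
        rewrite xt oppr_eq0 -(fmorph_eq0 (in_alg L)).
    case/eqP: (noN1 (w / t%:A));
      rewrite expr_div_n w2 xt -alg_sqr scaleNr mulNr divff //.
    by rewrite alg_sqr sqrf_eq0.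
  by case/eqP: (noN1 t%:A); rewrite -alg_sqr t2 scaleN1r.
have G_odd := galois_group_odd L_galois L2 L_abelian no_sqrt.
have [a [b qab]] : is_norm (p%:R : F) q%:R.
  apply: (odd_degree_norm L_galois G_odd (u := u) (v := v)) => //.
  by rewrite -!(rmorph_nat (in_alg L)) /= in quv.
have split_aniso (p' : nat) (q' : int) : prime p' -> odd p' ->
  legendre d p' = 1 -> legendre q' p' = (-1) ->
    forall X Y Z : F, (X ^+ 2 = p'%:R * Y ^+ 2 + q'%:~R * Z ^+ 2) ->
      [/\ X = 0, Y = 0 & Z = 0].
  move=> p'_pr p'_odd dp' q'p'.
  have [t tp] := legendre_eq1_sqrt p'_pr p'_odd dp'.
  apply: (split_prime_anisotropic s_sqrt F_gen F_imaginary p'_pr p'_odd tp) =>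
    //.
  apply/negP => pt; have : legendre d p' = 0; last by rewrite dp'.
  apply/eqP; rewrite legendre_eq0 //.
  by rewrite -(subKr (t ^+ 2) d) rpredB // dvdz_mulr.
(* A solution with a coordinate equal to 1; the descent at whichever of p and q splits makes this
   coordinate vanish. *)
have e : (a ^+ 2 = p%:R * b ^+ 2 + q%:R * 1 ^+ 2) by rewrite qab; ring.
have one0 : (1 : F) <> 0 by apply/eqP/oner_neq0.
case: split_pq => split_p.
  by case: (split_aniso p q p_prime p_odd split_p qpN a b 1 e) => _ _ /one0.
have e' : (a ^+ 2 = q%:R * 1 ^+ 2 + p%:R * b ^+ 2) by rewrite addrC.
by case: (split_aniso q p q_prime q_odd split_p pq_nonresidue a 1 b e') =>
  _ /one0.
Qed.
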